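(* ($\mathbf{ZF}$) Let $\langle X,d\rangle$ be an iso-dense metric space such that either $d$ is totally bounded or $\langle X,\tau(d)\rangle$ is limit point compact. Then $\langle X,\tau(d)\rangle$ has a cuf base and can be embedded in a metrizable Tychonoff cube.
   Context: The theorem is in $\mathbf{ZF}$ (no axiom of choice). $\tau(d)$ is the topology induced by the metric $d$. A space is iso-dense if its set of isolated points is dense. A metric $d$ on $X$ is totally bounded if, for every $\varepsilon>0$, $X$ is covered by finitely many $d$-balls of radius $\varepsilon$. A space is limit point compact if every infinite subset has an accumulation point in the space. A cuf set is a countable union of finite sets; a cuf base is a base (of the topology) which is a cuf set. A Tychonoff cube is a product space $[0,1]^J$ for an infinite set $J$. *)

(* Defs.v *)
(* A statement "ZF proves phi" is rendered as "phi holds in every model of ZF"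
   (in the sense of Tarski).  The theorem cannot be stated about Rocq's own
   types or sets, because the usual classical axioms of Rocq's libraries include
   choice, which would, for instance, make every cuf set countable.

   Separation and Replacement are first-order schemas, ranging over formulas
   of the language {mem, =} with parameters.  (Allowing arbitrary Rocq
   predicates instead would give second-order ZF, whose models inherit choice
   from the metatheory.)

   All set-theoretic notions below are written relationally and quantify
   over elements of the model only, so that each of them unfolds to a
   first-order formula of the language of set theory. *)

Set Implicit Arguments.
Unset Strict Implicit.

Record set_structure := SetStructure {
  carrier :> Type;
  mem : carrier -> carrier -> Prop
}.

Notation "x ∈ a" := (mem x a) (at level 70, no associativity).

(* De Bruijn indices: variable 0 is the innermost bound one. *)
Inductive formula :=
| Fmem (i j : nat)
| Feq (i j : nat)
| Fbot
| Fimp (p q : formula)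
| Fand (p q : formula)
| For (p q : formula)
| Fall (p : formula)
| Fex (p : formula).

Definition scons (T : Type) (x : T) (rho : nat -> T) (n : nat) : T :=
  match n with O => x | S m => rho m end.

Fixpoint sat (V : set_structure) (rho : nat -> V) (p : formula) : Prop :=
  match p with
  | Fmem i j => rho i ∈ rho j
  | Feq i j => rho i = rho j
  | Fbot => False
  | Fimp p q => sat rho p -> sat rho q
  | Fand p q => sat rho p /\ sat rho q
  | For p q => sat rho p \/ sat rho q
  | Fall p => forall x : V, sat (scons x rho) p
  | Fex p => exists x : V, sat (scons x rho) p
  end.

Section SetNotions.
Context {V : set_structure}.
Implicit Types a b c f p s t x y z w A B C F U W X Y T : V.

Definition is_empty a := forall x, ~ x ∈ a.
Definition incl a b := forall x, x ∈ a -> x ∈ b.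
Definition is_upair p a b := forall x, x ∈ p <-> x = a \/ x = b.
Definition is_union U F := forall x, x ∈ U <-> exists s, s ∈ F /\ x ∈ s.
Definition is_succ s x := forall y, y ∈ s <-> y ∈ x \/ y = x.

(* Kuratowski pair {{a},{a,b}} *)
Definition is_pair p a b :=
  exists s t, is_upair s a a /\ is_upair t a b /\ is_upair p s t.

Definition is_prod P A B :=
  forall p, p ∈ P <-> exists a b, a ∈ A /\ b ∈ B /\ is_pair p a b.

(* Functions are identified with their graphs; [maps f a b] is f(a) = b. *)
Definition maps f a b := exists p, is_pair p a b /\ p ∈ f.

Definition is_fun f A B :=
  (forall p, p ∈ f -> exists a b, a ∈ A /\ b ∈ B /\ is_pair p a b) /\
  (forall a, a ∈ A -> exists! b, maps f a b).

Definition injective_fun f :=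
  forall a a' b, maps f a b -> maps f a' b -> a = a'.

Definition is_bijection f A B :=
  is_fun f A B /\ injective_fun f /\
  (forall b, b ∈ B -> exists a, a ∈ A /\ maps f a b).

(* [maps2 f a b c] is f(a, b) = c. *)
Definition maps2 f a b c := exists p, is_pair p a b /\ maps f p c.
Definition is_fun2 f A B C := exists P, is_prod P A B /\ is_fun f P C.

Definition is_inductive w :=
  (exists z, is_empty z /\ z ∈ w) /\
  (forall x, x ∈ w -> exists s, is_succ s x /\ s ∈ w).

Definition is_omega w :=
  is_inductive w /\ forall w', is_inductive w' -> incl w w'.

Definition is_finite A :=
  exists w n f, is_omega w /\ n ∈ w /\ is_bijection f A n.

Definition is_infinite A := ~ is_finite A.

Definition is_countable A :=
  exists w f, is_omega w /\ is_fun f A w /\ injective_fun f.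

Definition is_cuf A :=
  exists F, is_countable F /\ (forall s, s ∈ F -> is_finite s) /\ is_union A F.

End SetNotions.

Record ZF (V : set_structure) : Prop := {
  ZF_extensionality : forall a b : V, (forall x, x ∈ a <-> x ∈ b) -> a = b;
  ZF_foundation : forall a : V, (exists x, x ∈ a) ->
    exists x, x ∈ a /\ forall y, y ∈ x -> ~ y ∈ a;
  ZF_pairing : forall a b : V, exists p, is_upair p a b;
  ZF_union : forall F : V, exists U, is_union U F;
  ZF_powerset : forall a : V, exists P : V, forall s, s ∈ P <-> incl s a;
  ZF_infinity : exists w : V, is_inductive w;
  ZF_separation : forall (phi : formula) (rho : nat -> V) (a : V),
    exists b : V, forall x, x ∈ b <-> x ∈ a /\ sat (scons x rho) phi;
  ZF_replacement : forall (phi : formula) (rho : nat -> V) (a : V),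
    (forall x y y' : V, x ∈ a ->
       sat (scons y (scons x rho)) phi -> sat (scons y' (scons x rho)) phi ->
       y = y') ->
    exists b : V, forall y,
      y ∈ b <-> exists x, x ∈ a /\ sat (scons y (scons x rho)) phi
}.

(* The real numbers of the model: any complete ordered field of the model.
   ZF proves that one exists and that it is unique up to a unique
   isomorphism. *)
Record real_data (V : set_structure) := RealData {
  reals : V;
  radd : V;
  rmul : V;
  rle : V;
  rzero : V;
  rone : V
}.

Section Reals.
Context {V : set_structure} (R : real_data V).
Implicit Types a b c u v x y z S : V.

Definition add a b c := maps2 (radd R) a b c.
Definition mul a b c := maps2 (rmul R) a b c.
Definition le a b := exists p, is_pair p a b /\ p ∈ rle R.
Definition lt a b := le a b /\ a <> b.
Definition positive a := a ∈ reals R /\ lt (rzero R) a.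

Definition upper_bound S u := u ∈ reals R /\ forall x, x ∈ S -> le x u.

Record complete_ordered_field : Prop := {
  cof_add : is_fun2 (radd R) (reals R) (reals R) (reals R);
  cof_mul : is_fun2 (rmul R) (reals R) (reals R) (reals R);
  cof_le : forall p, p ∈ rle R ->
    exists a b, a ∈ reals R /\ b ∈ reals R /\ is_pair p a b;
  cof_zero : rzero R ∈ reals R;
  cof_one : rone R ∈ reals R;
  cof_addA : forall a b c x y z,
    add a b x -> add x c y -> add b c z -> add a z y;
  cof_addC : forall a b c, add a b c -> add b a c;
  cof_add0 : forall a, a ∈ reals R -> add a (rzero R) a;
  cof_opp : forall a, a ∈ reals R ->
    exists b, b ∈ reals R /\ add a b (rzero R);
  cof_mulA : forall a b c x y z,
    mul a b x -> mul x c y -> mul b c z -> mul a z y;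
  cof_mulC : forall a b c, mul a b c -> mul b a c;
  cof_mul1 : forall a, a ∈ reals R -> mul a (rone R) a;
  cof_inv : forall a, a ∈ reals R -> a <> rzero R ->
    exists b, b ∈ reals R /\ mul a b (rone R);
  cof_distr : forall a b c s x u v,
    add b c s -> mul a s x -> mul a b u -> mul a c v -> add u v x;
  cof_one_neq_zero : rone R <> rzero R;
  cof_le_refl : forall a, a ∈ reals R -> le a a;
  cof_le_antisym : forall a b, le a b -> le b a -> a = b;
  cof_le_trans : forall a b c, le a b -> le b c -> le a c;
  cof_le_total : forall a b, a ∈ reals R -> b ∈ reals R -> le a b \/ le b a;
  cof_le_add : forall a b c x y,
    le a b -> add a c x -> add b c y -> le x y;
  cof_le_mul : forall a b c,
    le (rzero R) a -> le (rzero R) b -> mul a b c -> le (rzero R) c;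
  cof_complete : forall S, incl S (reals R) ->
    (exists x, x ∈ S) -> (exists u, upper_bound S u) ->
    exists u, upper_bound S u /\ forall v, upper_bound S v -> le u v
}.

Definition is_unit_interval I :=
  forall x, x ∈ I <-> x ∈ reals R /\ le (rzero R) x /\ le x (rone R).

(* |x - y| < e, i.e. x < y + e and y < x + e *)
Definition close x y e :=
  exists s t, add y e s /\ lt x s /\ add x e t /\ lt y t.

(* T is the subspace topology that A inherits from the real line. *)
Definition is_usual_topology A T :=
  forall U, U ∈ T <-> incl U A /\
    forall x, x ∈ U -> exists e, positive e /\
      forall y, y ∈ A -> close x y e -> y ∈ U.

End Reals.

Section Topology.
Context {V : set_structure}.
Implicit Types b e s x y A B D O T U W X Y : V.

Definition isolated T x := exists s, is_upair s x x /\ s ∈ T.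

Definition dense X T D :=
  incl D X /\
  forall U, U ∈ T -> (exists x, x ∈ U) -> exists x, x ∈ U /\ x ∈ D.

Definition iso_dense X T :=
  exists D, (forall x, x ∈ D <-> x ∈ X /\ isolated T x) /\ dense X T D.

Definition accumulation_point T A x :=
  forall U, U ∈ T -> x ∈ U -> exists y, y ∈ U /\ y ∈ A /\ y <> x.

Definition limit_point_compact X T :=
  forall A, incl A X -> is_infinite A ->
    exists x, x ∈ X /\ accumulation_point T A x.

Definition is_base B T :=
  incl B T /\
  forall U x, U ∈ T -> x ∈ U -> exists b, b ∈ B /\ x ∈ b /\ incl b U.

Definition is_image Y e A :=
  forall y, y ∈ Y <-> exists x, x ∈ A /\ maps e x y.

Definition is_preimage U X e O :=
  forall x, x ∈ U <-> x ∈ X /\ exists y, y ∈ O /\ maps e x y.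

Definition is_subspace Y TY T :=
  forall W, W ∈ TY <->
    exists U, U ∈ T /\ forall y, y ∈ W <-> y ∈ U /\ y ∈ Y.

Definition is_homeomorphism e X T Y TY :=
  is_bijection e X Y /\
  (forall O U, O ∈ TY -> is_preimage U X e O -> U ∈ T) /\
  (forall U O, U ∈ T -> is_image O e U -> O ∈ TY).

Definition is_embedding e X T Y TY :=
  is_fun e X Y /\
  exists Z TZ, is_image Z e X /\ is_subspace Z TZ TY /\
    is_homeomorphism e X T Z TZ.

(* P is the set of all functions from J to A. *)
Definition is_power P J A := forall f, f ∈ P <-> is_fun f J A.

(* W is the preimage of an open set O of A under a projection P -> A. *)
Definition is_subbasic P J TA W :=
  exists j O, j ∈ J /\ O ∈ TA /\
    forall f, f ∈ W <-> f ∈ P /\ exists y, y ∈ O /\ maps f j y.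

(* T is the product topology of P = A^J, where TA is the topology of A: the
   topology on P that has the sets in [is_subbasic] as a subbase. *)
Definition is_product_topology P J TA T :=
  forall U, U ∈ T <-> incl U P /\
    forall f, f ∈ U -> exists F, is_finite F /\
      (forall W, W ∈ F -> is_subbasic P J TA W /\ f ∈ W) /\
      (forall g, g ∈ P -> (forall W, W ∈ F -> g ∈ W) -> g ∈ U).

End Topology.

Section Metric.
Context {V : set_structure} (R : real_data V).
Implicit Types d x y z r s t e b B X T : V.

Record is_metric X d : Prop := {
  metric_fun : is_fun2 d X X (reals R);
  metric_ge0 : forall x y r, maps2 d x y r -> le R (rzero R) r;
  metric_eq0 : forall x y r, maps2 d x y r -> (r = rzero R <-> x = y);
  metric_sym : forall x y r, maps2 d x y r -> maps2 d y x r;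
  metric_triangle : forall x y z r s t u,
    maps2 d x y r -> maps2 d y z s -> maps2 d x z t -> add R r s u -> le R t u
}.

Definition is_ball b X d x e :=
  forall y, y ∈ b <-> y ∈ X /\ exists r, maps2 d x y r /\ lt R r e.

Definition is_metric_topology T X d :=
  forall U, U ∈ T <-> incl U X /\
    forall x, x ∈ U -> exists e b,
      positive R e /\ is_ball b X d x e /\ incl b U.

Definition totally_bounded X d :=
  forall e, positive R e -> exists F, is_finite F /\
    (forall b, b ∈ F -> exists x, x ∈ X /\ is_ball b X d x e) /\
    (forall y, y ∈ X -> exists b, b ∈ F /\ y ∈ b).

Definition metrizable X T :=
  exists d, is_metric X d /\ is_metric_topology T X d.

(* C, with topology TC, is the product space [0,1]^J for an infinite set J. *)
Definition is_tychonoff_cube C TC :=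
  exists J I TI, is_infinite J /\
    is_unit_interval R I /\ is_usual_topology R I TI /\
    is_power C J I /\ is_product_topology C J TI TC.

End Metric.

(* Main.v *)
(** A point [x] of an iso-dense metric space is isolated when the ball
    [B(x, eps)] is [{x}] for some [eps > 0].  For fixed [eps] the set [D_eps] of
    these points is finite: under total boundedness a ball of radius [eps / 2]
    holds at most one of them, and under limit point compactness they would
    otherwise accumulate, although they are [eps]-separated.  So the set [D] of
    isolated points is the union of the finite sets [D_(2^-n)].  As [D] is dense,
    the balls [B(x, 2^-m)] with [x] in [D] form a base; it is cuf because only
    finitely many of them have [x] in [D_(2^-n)] and [m <= n].

    For the cube take [J = D U {2^-n}] (the powers only make [J] infinite).
    Let [K j r] mean that [j] is in [D_r] or is a power [2^-n >= r]; for fixed [r]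
    this holds for finitely many [j], so [[0,1]^J] is metrized by
      [rho f g = sup {r <= 1 : r = 0 or |f j - g j| >= r for some j with K j r}],
    and [x |-> min(1, d(x, j))] (on [D], and 0 elsewhere) is an embedding.

    In a model of ZF every set so formed has to come from Separation for a
    first-order formula; [definable] expresses that such a formula exists.  The
    reals of the model, seen from outside, form an ordered field. *)

From HB Require Import structures.
From mathcomp Require Import all_boot all_order all_algebra lra boolp.
Require Import Defs.

Set Implicit Arguments.
Unset Strict Implicit.
Unset Printing Implicit Defensive.

(** * Definability with parameters *)

Section Definability.
Context {V : set_structure}.
Implicit Types (rho sig : nat -> V) (P Q : (nat -> V) -> Prop).

Definition lift_renaming (f : nat -> nat) n := if n is m.+1 then (f m).+1 else 0.

Fixpoint rename (f : nat -> nat) (p : formula) : formula :=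
  match p with
  | Fmem i j => Fmem (f i) (f j)
  | Feq i j => Feq (f i) (f j)
  | Fbot => Fbot
  | Fimp p q => Fimp (rename f p) (rename f q)
  | Fand p q => Fand (rename f p) (rename f q)
  | For p q => For (rename f p) (rename f q)
  | Fall p => Fall (rename (lift_renaming f) p)
  | Fex p => Fex (rename (lift_renaming f) p)
  end.

Lemma sat_rename p : forall f rho rho', (forall n, rho' n = rho (f n)) ->
  sat rho (rename f p) <-> sat rho' p.
Proof.
elim: p => [i j|i j||p IHp q IHq|p IHp q IHq|p IHp q IHq|p IHp|p IHp]
  f rho rho' E /=; rewrite ?E //.
1,2,3: by rewrite (IHp f rho rho' E) (IHq f rho rho' E).
all: have E' x n : scons x rho' n = scons x rho (lift_renaming f n)
  by case: n => [|n] /=.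
- by split=> H x; have := H x; rewrite (IHp _ _ _ (E' x)).
- by split=> -[x H]; exists x; move: H; rewrite (IHp _ _ _ (E' x)).
Qed.

(** Renaming by [id] replaces an assignment by a pointwise equal one without functional
    extensionality. *)
Lemma rename_id_sat p rho rho' : (forall n, rho' n = rho n) ->
  sat rho (rename id p) <-> sat rho' p.
Proof. by move=> E; apply: sat_rename. Qed.

(* The first [k] variables are free, the others hold the parameters [sig]. *)
Definition splice k rho sig n := if n < k then rho n else sig (n - k).

(* The premise [V] makes a default parameter available. *)
Definition definable k P :=
  V -> exists phi sig, forall rho, sat (splice k rho sig) phi <-> P rho.

(** Renaming sends the parameter at position [n] to position [h n], so a formula can read its
    parameters from a larger list. *)
Lemma definable_params k P phi sig sig' (h : nat -> nat) :
  (forall rho, sat (splice k rho sig) phi <-> P rho) ->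
  (forall n, sig' (h n) = sig n) ->
  exists phi', forall rho, sat (splice k rho sig') phi' <-> P rho.
Proof.
move=> H E; exists (rename (fun n => if n < k then n else k + h (n - k)) phi) => rho.
rewrite -H; apply: sat_rename => n; rewrite /splice.
case: ltnP => [->//|le_kn].
by rewrite ltnNge leq_addr /= addKn E.
Qed.

(** The two parameter lists are interleaved, the first on the even and the second on the odd
    positions. *)
Lemma definable_common_params k P Q : definable k P -> definable k Q ->
  V -> exists phi psi sig, forall rho,
    (sat (splice k rho sig) phi <-> P rho) /\
    (sat (splice k rho sig) psi <-> Q rho).
Proof.
move=> dP dQ v; have [phi [sig1 H1]] := dP v; have [psi [sig2 H2]] := dQ v.
pose sig n := if odd n then sig2 n./2 else sig1 n./2.
have [phi' H1'] : exists phi', forall rho, sat (splice k rho sig) phi' <-> P rho.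
  apply: (definable_params (h := double) H1) => n.
  by rewrite /sig odd_double doubleK.
have [psi' H2'] : exists psi', forall rho, sat (splice k rho sig) psi' <-> Q rho.
  apply: (definable_params (h := fun n => n.*2.+1) H2) => n.
  by rewrite /sig /= odd_double /= uphalf_double.
by exists phi', psi', sig.
Qed.

Lemma definable_and k P Q : definable k P -> definable k Q ->
  definable k (fun rho => P rho /\ Q rho).
Proof.
move=> dP dQ v; have [phi [psi [sig H]]] := definable_common_params dP dQ v.
by exists (Fand phi psi), sig => rho /=; have [-> ->] := H rho.
Qed.

Lemma definable_or k P Q : definable k P -> definable k Q ->
  definable k (fun rho => P rho \/ Q rho).
Proof.
move=> dP dQ v; have [phi [psi [sig H]]] := definable_common_params dP dQ v.
by exists (For phi psi), sig => rho /=; have [-> ->] := H rho.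
Qed.

Lemma definable_imp k P Q : definable k P -> definable k Q ->
  definable k (fun rho => P rho -> Q rho).
Proof.
move=> dP dQ v; have [phi [psi [sig H]]] := definable_common_params dP dQ v.
by exists (Fimp phi psi), sig => rho /=; have [-> ->] := H rho.
Qed.

Lemma definable_False k : definable k (fun _ => False).
Proof. by move=> v; exists Fbot, (fun _ => v). Qed.

Lemma definable_not k P : definable k P -> definable k (fun rho => ~ P rho).
Proof. by move=> dP; apply: definable_imp => //; apply: definable_False. Qed.

Lemma definable_iff k P Q : definable k P -> definable k Q ->
  definable k (fun rho => P rho <-> Q rho).
Proof. by move=> dP dQ; apply: definable_and; apply: definable_imp. Qed.

Lemma sat_scons_splice k x rho sig phi :
  sat (scons x (splice k rho sig)) (rename id phi) <->
  sat (splice k.+1 (scons x rho) sig) phi.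
Proof. by apply: rename_id_sat; case. Qed.

Lemma definable_forall k (Q : V -> (nat -> V) -> Prop) :
  definable k.+1 (fun rho => Q (rho 0) (fun n => rho n.+1)) ->
  definable k (fun rho => forall x, Q x rho).
Proof.
move=> dQ v; have [phi [sig H]] := dQ v.
exists (Fall (rename id phi)), sig => rho /=.
by split=> h x; move: (h x); rewrite sat_scons_splice H.
Qed.

Lemma definable_exists k (Q : V -> (nat -> V) -> Prop) :
  definable k.+1 (fun rho => Q (rho 0) (fun n => rho n.+1)) ->
  definable k (fun rho => exists x, Q x rho).
Proof.
move=> dQ v; have [phi [sig H]] := dQ v.
exists (Fex (rename id phi)), sig => rho /=.
by split=> -[x h]; exists x; move: h; rewrite sat_scons_splice H.
Qed.

(** The language has no function symbols, so a term is one of the [k] free variables or a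
    parameter. *)
Variant term k : ((nat -> V) -> V) -> Prop :=
| term_var i of i < k : term k (fun rho => rho i)
| term_const c : term k (fun=> c).

Lemma splice_lt k rho sig i : i < k -> splice k rho sig i = rho i.
Proof. by rewrite /splice => ->. Qed.

Lemma splice_add k rho sig m : splice k rho sig (k + m) = sig m.
Proof. by rewrite /splice ltnNge leq_addr addKn. Qed.

Lemma term_splice k t u : V -> term k t -> term k u ->
  exists i j sig, forall rho,
    splice k rho sig i = t rho /\ splice k rho sig j = u rho.
Proof.
move=> v [i lt_ik|c] [j lt_jk|c'].
- by exists i, j, (fun=> v) => rho; rewrite !splice_lt.
- by exists i, (k + 0), (fun=> c') => rho; rewrite splice_add splice_lt.
- by exists (k + 0), j, (fun=> c) => rho; rewrite splice_add splice_lt.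
- by exists (k + 0), (k + 1), (fun n => if n is 0 then c else c') => rho;
    rewrite !splice_add.
Qed.

Lemma definable_mem k t u : term k t -> term k u ->
  definable k (fun rho => t rho ∈ u rho).
Proof.
move=> tt tu v; have [i [j [sig E]]] := term_splice v tt tu.
by exists (Fmem i j), sig => rho /=; have [-> ->] := E rho.
Qed.

Lemma definable_eq k t u : term k t -> term k u ->
  definable k (fun rho => t rho = u rho).
Proof.
move=> tt tu v; have [i [j [sig E]]] := term_splice v tt tu.
by exists (Feq i j), sig => rho /=; have [-> ->] := E rho.
Qed.

(** Being a [term] is a proposition, so the codes are picked with choice of the metatheory. The
    model itself gains no choice from this. *)
Lemma term_code m k (s : nat -> (nat -> V) -> V) : V ->
  (forall i, i < m -> term k (s i)) ->
  exists code : nat -> nat + V, forall i, i < m ->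
    match code i with
    | inl j => j < k /\ s i = (fun rho => rho j)
    | inr c => s i = (fun=> c)
    end.
Proof.
move=> v ts; suff H i : exists c : nat + V, i < m ->
    match c with
    | inl j => j < k /\ s i = (fun rho => rho j)
    | inr c => s i = (fun=> c)
    end.
  by exists (fun i => projT1 (cid (H i))) => i; apply: (projT2 (cid (H i))).
have [lt_im|//] := ltnP i m; last by exists (inr v).
by case: (ts i lt_im) => [j lt_jk|c]; [exists (inl j)|exists (inr c)].
Qed.

Lemma definable_subst m k P (s : nat -> (nat -> V) -> V) :
  definable m P -> (forall i, i < m -> term k (s i)) ->
  definable k (fun rho => P (fun i => s i rho)).
Proof.
move=> dP ts v; have [phi [sig H]] := dP v; have [code Hc] := term_code v ts.
(* Even parameter positions keep the old parameters; odd ones store the constants that are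
   substituted for variables. *)
pose sig' n := if odd n then (if code n./2 is inr c then c else v) else sig n./2.
pose f i := if i < m then (if code i is inl j then j else k + i.*2.+1)
  else k + (i - m).*2.
exists (rename f phi), sig' => rho; rewrite -H; apply: sat_rename => i.
rewrite {1}/splice /f; case: ifP => lt_im; last first.
  by rewrite splice_add /sig' odd_double doubleK.
have := Hc i lt_im; case E: (code i) => [j|c].
  by case=> lt_jk ->; rewrite splice_lt.
by rewrite splice_add /sig' /= odd_double /= uphalf_double E => ->.
Qed.

Lemma definable1 k (F : V -> Prop) t :
  definable 1 (fun rho => F (rho 0)) -> term k t ->
  definable k (fun rho => F (t rho)).
Proof. by move=> dF tt; apply: (definable_subst (s := fun=> t) dF). Qed.

Lemma definable2 k (F : V -> V -> Prop) t u :
  definable 2 (fun rho => F (rho 0) (rho 1)) -> term k t -> term k u ->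
  definable k (fun rho => F (t rho) (u rho)).
Proof.
move=> dF tt tu.
by apply: (definable_subst (s := fun i => if i is 0 then t else u) dF) => -[].
Qed.

Lemma definable3 k (F : V -> V -> V -> Prop) t u w :
  definable 3 (fun rho => F (rho 0) (rho 1) (rho 2)) ->
  term k t -> term k u -> term k w ->
  definable k (fun rho => F (t rho) (u rho) (w rho)).
Proof.
move=> dF tt tu tw.
apply: (definable_subst
  (s := fun i => match i with 0 => t | 1 => u | _ => w end) dF).
by case=> [|[]].
Qed.

Lemma definable4 k (F : V -> V -> V -> V -> Prop) t u w z :
  definable 4 (fun rho => F (rho 0) (rho 1) (rho 2) (rho 3)) ->
  term k t -> term k u -> term k w -> term k z ->
  definable k (fun rho => F (t rho) (u rho) (w rho) (z rho)).
Proof.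
move=> dF tt tu tw tz.
apply: (definable_subst
  (s := fun i => match i with 0 => t | 1 => u | 2 => w | _ => z end) dF).
by case=> [|[|[]]].
Qed.

(** This form hides the syntax: later constructions only show that their predicate is definable. *)
Lemma separation (hV : ZF V) (P : V -> Prop) :
  definable 1 (fun rho => P (rho 0)) ->
  forall a, exists b, forall x, x ∈ b <-> x ∈ a /\ P x.
Proof.
move=> dP a; have [phi [sig H]] := dP a.
have [b Hb] := ZF_separation hV (rename id phi) sig a.
have E x : sat (scons x sig) (rename id phi) <-> P x.
  rewrite -(H (scons x sig)); apply: rename_id_sat.
  by case=> //= n; rewrite /splice /= subn1.
by exists b => x; rewrite Hb E.
Qed.

End Definability.

(** * Proof search for definability *)

Ltac solve_term := first
  [ apply: term_const | apply: term_var; first [reflexivity | eassumption] ].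

(** A hook, redefined once the basic set-theoretic notions are known to be definable. *)
Ltac definable_notion := fail.

(** The predicate is read off the type of [dF] and passed explicitly, which avoids higher-order
    unification. *)
Ltac definable_by dF :=
  lazymatch type of dF with
  | definable 1 (fun rho => ?F (rho 0)) => apply: (@definable1 _ _ F _ dF)
  | definable 2 (fun rho => ?F (rho 0) (rho 1)) =>
      apply: (@definable2 _ _ F _ _ dF)
  | definable 3 (fun rho => ?F (rho 0) (rho 1) (rho 2)) =>
      apply: (@definable3 _ _ F _ _ _ dF)
  | definable 4 (fun rho => ?F (rho 0) (rho 1) (rho 2) (rho 3)) =>
      apply: (@definable4 _ _ F _ _ _ _ dF)
  end; solve_term.

(** Known notions and hypotheses come before the connectives, so that they count as atoms and are
    not unfolded. *)
Ltac definable_step := cbn beta; first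
  [ definable_notion
  | match goal with dF : definable _ _ |- _ => definable_by dF end
  | apply: definable_and | apply: definable_or | apply: definable_iff
  | apply: definable_False | apply: definable_not
  | apply: definable_mem; solve_term
  | apply: definable_eq; solve_term
  | apply: definable_forall | apply: definable_exists | apply: definable_imp ].

Ltac definable := repeat definable_step.

(** * Definability of the notions that occur in the constructions *)

Section DefinableNotions.
Context {V : set_structure}.

Lemma definable_is_pair :
  definable 3 (fun rho : nat -> V => is_pair (rho 0) (rho 1) (rho 2)).
Proof. by rewrite /is_pair /is_upair; definable. Qed.

Lemma definable_maps :
  definable 3 (fun rho : nat -> V => maps (rho 0) (rho 1) (rho 2)).
Proof. by have dp := definable_is_pair; rewrite /maps; definable. Qed.

Lemma definable_maps2 :
  definable 4 (fun rho : nat -> V => maps2 (rho 0) (rho 1) (rho 2) (rho 3)).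
Proof.
by have dp := definable_is_pair; have dm := definable_maps;
   rewrite /maps2; definable.
Qed.

Lemma definable_is_finite : definable 1 (fun rho : nat -> V => is_finite (rho 0)).
Proof.
have dp := definable_is_pair; have dm := definable_maps.
rewrite /is_finite /is_bijection /injective_fun /is_fun /unique /is_omega.
by rewrite /is_inductive /is_empty /is_succ /incl; definable.
Qed.

Lemma definable_is_bijection : definable 3
  (fun rho : nat -> V => is_bijection (rho 0) (rho 1) (rho 2)).
Proof.
have dp := definable_is_pair; have dm := definable_maps.
by rewrite /is_bijection /injective_fun /is_fun /unique; definable.
Qed.

Context (R : real_data V).

Lemma definable_le : definable 2 (fun rho => le R (rho 0) (rho 1)).
Proof. by have dp := definable_is_pair; rewrite /le; definable. Qed.

Lemma definable_lt : definable 2 (fun rho => lt R (rho 0) (rho 1)).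
Proof. by have dl := definable_le; rewrite /lt; definable. Qed.

Lemma definable_add : definable 3 (fun rho => add R (rho 0) (rho 1) (rho 2)).
Proof. by have dm := definable_maps2; rewrite /add; definable. Qed.

Lemma definable_close : definable 3 (fun rho => close R (rho 0) (rho 1) (rho 2)).
Proof.
by have dl := definable_lt; have da := definable_add; rewrite /close; definable.
Qed.

End DefinableNotions.

Ltac definable_notion ::= first
  [ definable_by definable_is_pair | definable_by definable_maps
  | definable_by definable_maps2 | definable_by definable_is_finite
  | definable_by definable_is_bijection
  | match goal with R : real_data _ |- _ => first
      [ definable_by (definable_le R) | definable_by (definable_lt R)
      | definable_by (definable_add R) | definable_by (definable_close R) ] end
  | progress rewrite /is_upair /incl /is_empty /is_succ /is_inductive
      /positive /is_ball /unique ].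

(** * Sets, functions and finiteness in the model *)

Section Sets.
Context {V : set_structure} (hV : ZF V).
Implicit Types a b c f p r s t x y z w A B C F P U : V.

Lemma set_ext a b : (forall x, x ∈ a <-> x ∈ b) -> a = b.
Proof. exact: ZF_extensionality. Qed.

Lemma upair_eq s t a b a' b' : is_upair s a b -> is_upair t a' b' ->
  s = t -> (a = a' /\ b = b') \/ (a = b' /\ b = a').
Proof.
move=> hs ht E; rewrite -{}E in ht.
have /hs h1 : a' ∈ s by apply/ht; left.
have /hs h2 : b' ∈ s by apply/ht; right.
have /ht h3 : a ∈ s by apply/hs; left.
have /ht h4 : b ∈ s by apply/hs; right.
case: h1 h2 h3 h4 => [?|?] [?|?] [?|?] [?|?]; subst; tauto.
Qed.

Lemma is_pair_unique p p' a b : is_pair p a b -> is_pair p' a b -> p = p'.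
Proof.
have ue s t x y : is_upair s x y -> is_upair t x y -> s = t.
  by move=> hs ht; apply: set_ext => z; rewrite hs ht.
move=> [s [t [hs [ht hp]]]] [s' [t' [hs' [ht' hp']]]].
by rewrite -(ue _ _ _ _ hs hs') -(ue _ _ _ _ ht ht') in hp'; apply: ue hp hp'.
Qed.

Lemma is_pair_inj p a b a' b' : is_pair p a b -> is_pair p a' b' ->
  a = a' /\ b = b'.
Proof.
move=> [s [t [hs [ht hp]]]] [s' [t' [hs' [ht' hp']]]].
case: (upair_eq hp hp' erefl) => -[E1 E2].
  have [] := upair_eq hs hs' E1; have [] := upair_eq ht ht' E2;
  by move=> [? ?] [? ?]; subst.
have [] := upair_eq hs ht' E1; have [] := upair_eq ht hs' E2;
by move=> [? ?] [? ?]; subst.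
Qed.

Lemma is_pair_exists a b : exists p, is_pair p a b.
Proof.
have [s hs] := ZF_pairing hV a a; have [t ht] := ZF_pairing hV a b.
by have [p hp] := ZF_pairing hV s t; exists p, s, t.
Qed.

Lemma powerset_exists a : exists P, forall s, s ∈ P <-> incl s a.
Proof. exact: ZF_powerset. Qed.

Lemma setU_exists a b : exists U, forall x, x ∈ U <-> x ∈ a \/ x ∈ b.
Proof.
have [p hp] := ZF_pairing hV a b; have [U hU] := ZF_union hV p; exists U => x.
rewrite hU; split=> [[s [/hp[->|->]]]|[h|h]]; try tauto.
  by exists a; split=> //; apply/hp; left.
by exists b; split=> //; apply/hp; right.
Qed.

Lemma setU1_exists a y : exists U, forall x, x ∈ U <-> x ∈ a \/ x = y.
Proof.
have [s hs] := ZF_pairing hV y y; have [U hU] := setU_exists a s.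
by exists U => x; rewrite hU hs; tauto.
Qed.

Lemma set0_exists : exists z : V, is_empty z.
Proof. by have [w [[z [hz _]] _]] := ZF_infinity hV; exists z. Qed.

(** A Kuratowski pair of elements of the union [U] is a set of subsets of [U], so the product is cut
    out of the double power set of [U]. *)
Lemma prod_exists A B : exists P, is_prod P A B.
Proof.
have [U hU] := setU_exists A B; have [P1 h1] := powerset_exists U.
have [P2 h2] := powerset_exists P1.
have [P hP] : exists P, forall p, p ∈ P <-> p ∈ P2 /\
    exists a b, a ∈ A /\ b ∈ B /\ is_pair p a b.
  by apply: separation => //; definable.
exists P => p; rewrite hP; split=> [[]//|h]; split=> //.
case: h => [a [b [aA [bB [s [t [hs [ht hp]]]]]]]].
have [aU bU] : a ∈ U /\ b ∈ U by split; apply/hU; tauto.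
apply/h2 => x /hp[]->; apply/h1 => y; first by move=> /hs[]->.
by move=> /ht[]->.
Qed.

Lemma relation_exists (F : V -> V -> Prop) A B :
  definable 2 (fun rho => F (rho 0) (rho 1)) ->
  exists r, (forall p, p ∈ r -> exists a b, a ∈ A /\ b ∈ B /\ is_pair p a b) /\
    forall a b, maps r a b <-> a ∈ A /\ b ∈ B /\ F a b.
Proof.
move=> dF; have [P hP] := prod_exists A B.
have [r hr] : exists r, forall p, p ∈ r <-> p ∈ P /\
    exists a b, is_pair p a b /\ F a b.
  by apply: separation => //; definable.
exists r; split=> [p /hr[/hP]//|a b]; split.
  move=> [p [hp /hr[/hP[a' [b' [a'A [b'B hp']]]] [a'' [b'' [hp'' h]]]]]].
  have [? ?] := is_pair_inj hp hp'; have [? ?] := is_pair_inj hp hp''.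
  by subst.
move=> [aA [bB h]]; have [p hp] := is_pair_exists a b; exists p; split=> //.
by apply/hr; split; [apply/hP|]; exists a, b.
Qed.

(** A Rocq function, so that values can be rewritten; the default outside the domain is [f] itself.
    For a function of the model the value is unique, so [cid] chooses nothing. *)
Definition app f a : V :=
  if pselect (exists b, maps f a b) is left h then projT1 (cid h) else f.

Lemma maps_app f A B a : is_fun f A B -> a ∈ A -> maps f a (app f a).
Proof.
move=> [_ h] /h[b [hb _]]; rewrite /app; case: pselect => [e|[]]; last by exists b.
exact: (projT2 (cid e)).
Qed.

Lemma maps_dom f A B a b : is_fun f A B -> maps f a b -> a ∈ A /\ b ∈ B.
Proof.
move=> [h _] [p [hp /h[a' [b' [a'A [b'B hp']]]]]].
by have [-> ->] := is_pair_inj hp hp'.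
Qed.

Lemma mapsE f A B a b : is_fun f A B -> a ∈ A -> (maps f a b <-> app f a = b).
Proof.
move=> hf aA; have ha := maps_app hf aA; split=> [hb|<-//].
by have [c [_ uc]] := hf.2 a aA; rewrite -(uc _ ha) -(uc _ hb).
Qed.

Lemma maps_eq f A B a b : is_fun f A B -> maps f a b -> app f a = b.
Proof.
by move=> hf h; have [aA _] := maps_dom hf h; apply/(mapsE _ hf aA).
Qed.

Lemma app_in f A B a : is_fun f A B -> a ∈ A -> app f a ∈ B.
Proof. by move=> hf aA; have [] := maps_dom hf (maps_app hf aA). Qed.

Lemma fun_ext f g A B C : is_fun f A B -> is_fun g A C ->
  (forall a, a ∈ A -> app f a = app g a) -> f = g.
Proof.
suff H f' g' B' C' : is_fun f' A B' -> is_fun g' A C' ->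
    (forall a, a ∈ A -> app f' a = app g' a) -> forall p, p ∈ f' -> p ∈ g'.
  move=> hf hg E; apply: set_ext => p; split; apply: H; eauto.
  by move=> a aA; rewrite E.
move=> hf hg E p pf; have [a [b [aA [bB hp]]]] := hf.1 p pf.
have Eb : app f' a = b by apply: maps_eq hf _; exists p.
have [q [hq qg]] : maps g' a b by apply/(mapsE _ hg) => //; rewrite -E.
by rewrite (is_pair_unique hp hq).
Qed.

(** Without choice a function comes from a definable relation only when the value is unique; the
    graph is then the relation itself. *)
Lemma fun_exists (F : V -> V -> Prop) A B :
  definable 2 (fun rho => F (rho 0) (rho 1)) ->
  (forall a, a ∈ A -> exists b, b ∈ B /\ F a b) ->
  (forall a b b', a ∈ A -> b ∈ B -> b' ∈ B -> F a b -> F a b' -> b = b') ->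
  exists f, is_fun f A B /\ forall a, a ∈ A -> F a (app f a).
Proof.
move=> dF ex un; have [f [h hf]] := relation_exists A B dF.
have ff : is_fun f A B.
  split=> // a aA; have [b [bB Fab]] := ex a aA.
  exists b; split=> [|b']; first exact/hf.
  by move/hf=> [_ [b'B Fab']]; apply: un Fab Fab'.
by exists f; split=> // a aA; have /hf[_ []] := maps_app ff aA.
Qed.

Lemma powers_exists J A : exists P, is_power P J A.
Proof.
have [Q hQ] := prod_exists J A; have [PQ hPQ] := powerset_exists Q.
have [P hP] : exists P, forall f, f ∈ P <-> f ∈ PQ /\ is_fun f J A.
  by apply: separation => //; rewrite /is_fun; definable.
exists P => f; rewrite hP; split=> [[]//|hf]; split=> //.
by apply/hPQ => p /hf.1; rewrite hQ.
Qed.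

Definition app2 f a b : V :=
  if pselect (exists c, maps2 f a b c) is left h then projT1 (cid h) else f.

Lemma maps2_app2 f A B C a b : is_fun2 f A B C -> a ∈ A -> b ∈ B ->
  maps2 f a b (app2 f a b).
Proof.
move=> [P [hP hf]] aA bB; rewrite /app2; case: pselect => [e|[]].
  exact: (projT2 (cid e)).
have [p hp] := is_pair_exists a b; exists (app f p), p; split=> //.
by apply: maps_app hf _; apply/hP; exists a, b.
Qed.

Lemma maps2_dom f A B C a b c : is_fun2 f A B C -> maps2 f a b c ->
  [/\ a ∈ A, b ∈ B & c ∈ C].
Proof.
move=> [P [hP hf]] [p [hp h]]; have [/hP pP cC] := maps_dom hf h.
case: pP => [a' [b' [a'A [b'B hp']]]].
by have [-> ->] := is_pair_inj hp hp'.
Qed.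

Lemma maps2_eq f A B C a b c : is_fun2 f A B C -> maps2 f a b c ->
  app2 f a b = c.
Proof.
move=> ff h; have [aA bB _] := maps2_dom ff h.
have [p [hp hc]] := h; have [p' [hp' hc']] := maps2_app2 ff aA bB.
have [P [hP hf]] := ff; rewrite (is_pair_unique hp' hp) in hc'.
by rewrite -(maps_eq hf hc) -(maps_eq hf hc').
Qed.

Lemma maps2E f A B C a b c : is_fun2 f A B C -> a ∈ A -> b ∈ B ->
  (maps2 f a b c <-> app2 f a b = c).
Proof.
move=> hf aA bB; split; first exact: maps2_eq hf.
by move=> <-; apply: maps2_app2 hf _ _.
Qed.

Lemma app2_in f A B C a b : is_fun2 f A B C -> a ∈ A -> b ∈ B -> app2 f a b ∈ C.
Proof. by move=> hf aA bB; have [] := maps2_dom hf (maps2_app2 hf aA bB). Qed.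

Lemma fun2_exists (F : V -> V -> V -> Prop) A B C :
  definable 3 (fun rho => F (rho 0) (rho 1) (rho 2)) ->
  (forall a b, a ∈ A -> b ∈ B -> exists c, c ∈ C /\ F a b c) ->
  (forall a b c c', a ∈ A -> b ∈ B -> c ∈ C -> c' ∈ C ->
    F a b c -> F a b c' -> c = c') ->
  exists f, is_fun2 f A B C /\
    forall a b, a ∈ A -> b ∈ B -> F a b (app2 f a b).
Proof.
move=> dF ex un; have [P hP] := prod_exists A B.
have [f [ff hf]] : exists f, is_fun f P C /\ forall p, p ∈ P ->
    exists a b, is_pair p a b /\ F a b (app f p).
  apply: (fun_exists (F := fun p c => exists a b, is_pair p a b /\ F a b c)).
  - by definable.
  - move=> p /hP[a [b [aA [bB hp]]]]; have [c [cC h]] := ex a b aA bB.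
    by exists c; split=> //; exists a, b.
  - move=> p c c' /hP[a [b [aA [bB hp]]]] cC c'C.
    move=> [a1 [b1 [hp1 h1]]] [a2 [b2 [hp2 h2]]].
    have [? ?] := is_pair_inj hp hp1; have [? ?] := is_pair_inj hp hp2.
    by subst; apply: un h1 h2.
have f2 : is_fun2 f A B C by exists P.
exists f; split=> // a b aA bB; have [p [hp h]] := maps2_app2 f2 aA bB.
have [a' [b' [hp' h']]] : exists a b, is_pair p a b /\ F a b (app f p).
  by apply: hf; have [] := maps_dom ff h.
have [? ?] := is_pair_inj hp hp'; subst.
by rewrite (maps_eq ff h) in h'.
Qed.

End Sets.

(** * The set omega, induction, and finite sets *)

Section Finite.
Context {V : set_structure} (hV : ZF V).
Implicit Types a b c f p r s t x y z w n m A B C F P U : V.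

Lemma omega_exists : exists w, is_omega (V := V) w.
Proof.
have [w0 h0] := ZF_infinity hV.
(* Omega is the intersection of all inductive sets; the formula may quantify over all of them, but
   its elements are taken from the given one. *)
have [w hw] : exists w, forall x, x ∈ w <-> x ∈ w0 /\
    forall w', is_inductive w' -> x ∈ w'.
  by apply: separation => //; definable.
exists w; split; last by move=> w' iw' x /hw[_]; apply.
have se a : exists s, is_succ s a := setU1_exists hV a a.
have su a s s' : is_succ s a -> is_succ s' a -> s = s'.
  by move=> h h'; apply: set_ext => // y; rewrite h h'.
have ze z z' : is_empty z -> is_empty z' -> z = z' :> V.
  by move=> hz hz'; apply: set_ext => // y; split=> [/hz|/hz'].
split.
  have [z [hz zw0]] := h0.1; exists z; split=> //; apply/hw; split=> //.
  by move=> w' [[z' [hz' ?]] _]; rewrite (ze _ _ hz hz').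
move=> x /hw[xw0 hx]; have [s [hs sw0]] := h0.2 x xw0; exists s; split=> //.
apply/hw; split=> // w' hw'; have [s' [hs' s'w']] := hw'.2 x (hx w' hw').
by rewrite (su _ _ _ hs hs').
Qed.

(** The model may contain nonstandard numbers, so induction is available for definable predicates
    only: the part of [w] on which [P] holds is then an inductive set of the model. *)
Lemma omega_ind w (P : V -> Prop) : is_omega w ->
  definable 1 (fun rho => P (rho 0)) ->
  (forall z, is_empty z -> P z) ->
  (forall n s, n ∈ w -> P n -> is_succ s n -> P s) ->
  forall n, n ∈ w -> P n.
Proof.
move=> [[w0 wS] hw] dP P0 PS n nw.
have [u hu] : exists u, forall x, x ∈ u <-> x ∈ w /\ P x by apply: separation.
suff /hw/(_ n nw) : is_inductive u by move/hu=> [].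
split.
  by have [z [hz zw]] := w0; exists z; split=> //; apply/hu; split=> //; apply: P0.
move=> x /hu[xw Px]; have [s [hs sw]] := wS x xw; exists s; split=> //.
by apply/hu; split=> //; apply: PS hs.
Qed.

Lemma mem_irrefl a : ~ a ∈ a.
Proof.
move=> aa; have [s hs] := ZF_pairing hV a a.
have [|x [/hs h hx]] := ZF_foundation hV (a := s).
  by exists a; apply/hs; left.
have E : x = a by case: h.
by subst; apply: (hx a) => //; apply/hs; left.
Qed.

Lemma finite0 A : is_empty A -> is_finite A.
Proof.
move=> A0; have [w hw] := omega_exists; have [z [hz zw]] := hw.1.1.
exists w, z, z; do 2!split=> //; split; first by split=> [p /hz|a /A0].
by split=> [a a' b [p [_ /hz]]|b /hz].
Qed.

Lemma finite_setU1 A B y : is_finite A -> (forall x, x ∈ B <-> x ∈ A \/ x = y) ->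
  is_finite B.
Proof.
move=> [w [n [f [hw [nw bf]]]]] hB.
have [yA|yA] := pselect (y ∈ A).
  suff -> : B = A by exists w, n, f.
  by apply: set_ext => // x; rewrite hB; split=> [[|->]//|]; left.
have [s [hs sw]] := hw.1.2 n nw; have [ff [injf surf]] := bf.
(* The bijection [f] from [A] to [n] is extended by sending [y] to [n], the last element of the
   successor [s]. *)
have [g [gf hg]] : exists g, is_fun g B s /\ forall x, x ∈ B ->
    (x ∈ A /\ maps f x (app g x)) \/ (x = y /\ app g x = n).
  apply: (fun_exists hV
    (F := fun x v => (x ∈ A /\ maps f x v) \/ (x = y /\ v = n))).
  - by definable.
  - move=> x /hB[xA|->]; last by exists n; split; [apply/hs|]; right.
    exists (app f x); split; first by apply/hs; left; apply: app_in ff xA.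
    by left; split=> //; apply: maps_app ff xA.
  - move=> x v v' _ _ _ [[xA h]|[-> ->]] [[xA' h']|[E' ->]] //; subst=> //.
    by rewrite -(maps_eq ff h) -(maps_eq ff h').
exists w, s, g; do 2!split=> //; do 2!split=> //.
  move=> x x' v h h'; have [xB _] := maps_dom gf h.
  have [x'B _] := maps_dom gf h'.
  have := hg x xB; have := hg x' x'B.
  rewrite (maps_eq gf h) (maps_eq gf h').
  case=> [[xA e]|[-> ->]] [[x'A e']|[-> E]] //.
  - exact: injf e' e.
  - by subst; have [_ /mem_irrefl] := maps_dom ff e.
  - by have [_ /mem_irrefl] := maps_dom ff e'.
move=> v /hs[vn|->].
  have [x [xA h]] := surf v vn; have xB : x ∈ B by apply/hB; left.
  exists x; split=> //; apply/(mapsE _ gf xB).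
  case: (hg x xB) => [[_ h']|[E _]]; last by subst.
  by rewrite -(maps_eq ff h) -(maps_eq ff h').
have yB : y ∈ B by apply/hB; right.
exists y; split=> //; apply/(mapsE _ gf yB).
by case: (hg y yB) => -[].
Qed.

(** Induction on the number [n] of elements, with the set and its bijection generalized. *)
Lemma finite_ind (P : V -> Prop) : definable 1 (fun rho => P (rho 0)) ->
  (forall z, is_empty z -> P z) ->
  (forall A B y, is_finite A -> P A -> (forall x, x ∈ B <-> x ∈ A \/ x = y) ->
    P B) ->
  forall A, is_finite A -> P A.
Proof.
move=> dP P0 PS A [w [n [f [hw [nw bf]]]]].
suff H : forall n, n ∈ w -> forall A f, is_bijection f A n -> P A by apply: H bf.
apply: (omega_ind hw (P := fun n => forall A f, is_bijection f A n -> P A)).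
- by definable.
- move=> z hz {bf}A {}f [ff _]; apply: P0 => x xA.
  exact: hz (app_in ff xA).
move=> {nw bf}n s nw IH hs {}A {}f [ff [injf surf]].
(* The point [y] that [f] sends to the last element [n] of [s] is removed. *)
have [y [yA hy]] := surf n (proj2 (hs n) (or_intror erefl)).
have [A' hA'] : exists A', forall x, x ∈ A' <-> x ∈ A /\ ~ x = y.
  by apply: separation => //; definable.
have [g [gf hg]] : exists g, is_fun g A' n /\
    forall x, x ∈ A' -> maps f x (app g x).
  apply: (fun_exists hV (F := fun x v => maps f x v)).
  - by definable.
  - move=> x /hA'[xA xy]; exists (app f x); have h := maps_app ff xA.
    split=> //; have [_ /hs[//|E]] := maps_dom ff h.
    by case: xy; apply: injf h _; rewrite E.
  - move=> x v v' _ _ _ h h'.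
    by rewrite -(maps_eq ff h) -(maps_eq ff h').
have bg : is_bijection g A' n.
  split=> //; split.
    move=> x x' v h h'; have [xA _] := maps_dom gf h.
    have [x'A _] := maps_dom gf h'; have := hg x xA; have := hg x' x'A.
    rewrite (maps_eq gf h) (maps_eq gf h') => e e'; exact: injf e' e.
  move=> v vn; have [x [xA h]] := surf v (proj2 (hs v) (or_introl vn)).
  have xA' : x ∈ A'.
    apply/hA'; split=> // E; subst; case: (@mem_irrefl n).
    by rewrite -{1}(maps_eq ff hy) (maps_eq ff h).
  exists x; split=> //; apply/(mapsE _ gf xA').
  by rewrite -(maps_eq ff h) -(maps_eq ff (hg x xA')).
apply: (PS A' A y) => [||x].
- by exists w, n, g.
- exact: IH bg.
- rewrite hA'; split=> [xA|[[]//|->//]].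
  by have [->|] := pselect (x = y); [right|left].
Qed.

Lemma finite_setU A B C : is_finite A -> is_finite B ->
  (forall x, x ∈ C <-> x ∈ A \/ x ∈ B) -> is_finite C.
Proof.
move=> fA fB; move: C.
pose P A := forall C, (forall x, x ∈ C <-> x ∈ A \/ x ∈ B) -> is_finite C.
suff : forall A, is_finite A -> P A by move=> /(_ A fA).
apply: finite_ind; rewrite /P; first by definable.
  move=> z hz C hC; suff -> : C = B by [].
  by apply: set_ext => // x; rewrite hC; split=> [[/hz|]//|]; right.
move=> A1 A2 y _ IH hA2 C hC; have [C' hC'] := setU_exists hV A1 B.
by apply: (finite_setU1 (y := y) (IH C' hC')) => x; rewrite hC hA2 hC'; tauto.
Qed.

(** Induction on the index set avoids choosing enumerations of the fibres. Finiteness is assumed of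
    every set contained in a fibre, so that fibres need not be formed first. *)
Lemma finite_bigcup (F : V -> V -> Prop) A B :
  definable 2 (fun rho => F (rho 0) (rho 1)) -> is_finite A ->
  (forall x C, x ∈ A -> (forall y, y ∈ C -> y ∈ B /\ F x y) -> is_finite C) ->
  (forall y, y ∈ B -> exists x, x ∈ A /\ F x y) -> is_finite B.
Proof.
move=> dF fA fF hB.
pose P A' := incl A' A -> forall C,
  (forall y, y ∈ C -> y ∈ B /\ exists x, x ∈ A' /\ F x y) -> is_finite C.
suff : forall A, is_finite A -> P A.
  by move=> /(_ A fA); apply=> // y yB; split=> //; apply: hB.
apply: finite_ind; rewrite /P; first by definable.
  move=> z hz _ C hC; apply: finite0 => y /hC[_ [x [/hz]]] //.
move=> A1 A2 y _ IH hA2 sA2 C hC.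
have [C1 hC1] : exists C1, forall v, v ∈ C1 <-> v ∈ C /\
    exists x, x ∈ A1 /\ F x v.
  by apply: separation => //; definable.
have [C2 hC2] : exists C2, forall v, v ∈ C2 <-> v ∈ C /\ F y v.
  by apply: separation => //; definable.
apply: (@finite_setU C1 C2).
- apply: IH => [x xA1|v /hC1[/hC[vB _] h]//].
  by apply: sA2; apply/hA2; left.
- apply: (fF y) => [|v /hC2[/hC[vB _] h]//].
  by apply: sA2; apply/hA2; right.
- move=> v; rewrite hC1 hC2; split=> [vC|[[]//|[]//]].
  have [_ [x [/hA2[xA1|->] h]]] := hC v vC; last by right.
  by left; split=> //; exists x.
Qed.

Lemma finite_subsingleton A : (forall x y, x ∈ A -> y ∈ A -> x = y) -> is_finite A.
Proof.
move=> h; have [[x xA]|h0] := pselect (exists x, x ∈ A); last first.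
  by apply: finite0 => x xA; apply: h0; exists x.
have [z hz] := set0_exists hV.
apply: (finite_setU1 (finite0 hz) (y := x)) => y; split=> [yA|[/hz//|->//]].
by right; apply: h.
Qed.

(** A union of fibres with at most one point each; the relation [F] may be a partial function. *)
Lemma finite_image (F : V -> V -> Prop) A B :
  definable 2 (fun rho => F (rho 0) (rho 1)) -> is_finite A ->
  (forall x y y', x ∈ A -> y ∈ B -> y' ∈ B -> F x y -> F x y' -> y = y') ->
  (forall y, y ∈ B -> exists x, x ∈ A /\ F x y) -> is_finite B.
Proof.
move=> dF fA fun_F; apply: finite_bigcup fA _ => // x C xA hC.
by apply: finite_subsingleton => y y' /hC[? ?] /hC[? ?]; apply: fun_F xA _ _ _ _.
Qed.

Lemma finite_sub A B : is_finite A -> incl B A -> is_finite B.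
Proof.
move=> fA sBA; apply: (finite_image (F := fun x y => x = y) _ fA).
- by definable.
- by move=> x y y' _ _ _ <-.
- by move=> y /sBA yA; exists y.
Qed.

End Finite.

(** * The reals of the model as a real field *)

(** The proofs [hV] and [hR] are arguments of the type, so that the field and order structures,
    which depend on them, can be inferred from the type alone. *)
Definition real (V : set_structure) (hV : ZF V) (R : real_data V)
  (hR : complete_ordered_field R) : Type := {x : V | x ∈ reals R}.

Section RealField.
Context (V : set_structure) (hV : ZF V) (R : real_data V)
  (hR : complete_ordered_field R).
Local Notation RR := (real hV hR).
Implicit Types x y z : RR.

Definition elt x : V := sval x.

Lemma elt_in x : elt x ∈ reals R.
Proof. exact: (svalP x). Qed.

Lemma elt_inj : injective elt.
Proof. by move=> [x px] [y py] /= E; apply: eq_exist. Qed.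

Definition to_real a (aR : a ∈ reals R) : RR := exist (fun a => a ∈ reals R) a aR.

Lemma elt_surj a : a ∈ reals R -> exists x, elt x = a.
Proof. by move=> h; exists (to_real h). Qed.

Let zero : RR := to_real (cof_zero hR).
Let one : RR := to_real (cof_one hR).
Let plus x y : RR := to_real (app2_in hV (cof_add hR) (elt_in x) (elt_in y)).
Let times x y : RR := to_real (app2_in hV (cof_mul hR) (elt_in x) (elt_in y)).
Let leb x y : bool := `[< le R (elt x) (elt y) >].

Let addE x y z : add R (elt x) (elt y) (elt z) <-> z = plus x y.
Proof.
rewrite /add (maps2E hV _ (cof_add hR)); try exact: elt_in.
by split=> [E|->//]; apply: elt_inj.
Qed.

Let mulE x y z : mul R (elt x) (elt y) (elt z) <-> z = times x y.
Proof.
rewrite /mul (maps2E hV _ (cof_mul hR)); try exact: elt_in.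
by split=> [E|->//]; apply: elt_inj.
Qed.

Let oppP x : exists y, plus x y = zero.
Proof.
have [b [bR h]] := cof_opp hR (elt_in x); exists (to_real bR).
by have /addE -> : add R (elt x) (elt (to_real bR)) (elt zero) by [].
Qed.

Let opp x : RR := projT1 (cid (oppP x)).

(** The inverse of 0 is fixed to be 0, as the field structure demands. *)
Let invP x : exists y, (x <> zero -> times x y = one) /\ (x = zero -> y = zero).
Proof.
have [->|nz] := pselect (x = zero); first by exists zero.
have [|b [bR h]] := cof_inv hR (elt_in x) _; first by move=> E; apply/nz/elt_inj.
exists (to_real bR); split=> // _.
by have /mulE -> : mul R (elt x) (elt (to_real bR)) (elt one) by [].
Qed.

Let inv x : RR := projT1 (cid (invP x)).

(** Decidable equality and choice on this type belong to the classical metatheory and say nothing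
    about choice in the model. *)
HB.instance Definition _ := gen_eqMixin RR.
HB.instance Definition _ := gen_choiceMixin RR.

Let plusA : associative plus.
Proof.
move=> x y z; apply/esym/addE; apply: (cof_addA hR (b := elt y) (c := elt z)
  (x := elt (plus x y)) (z := elt (plus y z))).
- exact/addE.
- exact/addE.
- exact/addE.
Qed.

Let plusC : commutative plus.
Proof. by move=> x y; apply/addE; apply: cof_addC => //; apply/addE. Qed.

Let plus0 : left_id zero plus.
Proof.
move=> x; apply/esym/addE; apply: cof_addC => //.
exact: (cof_add0 hR (elt_in x)).
Qed.

Let plusN : left_inverse zero opp plus.
Proof. by move=> x; rewrite plusC /opp; case: cid. Qed.

HB.instance Definition _ := GRing.isZmodule.Build RR plusA plusC plus0 plusN.

Let timesA : associative times.
Proof.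
move=> x y z; apply/esym/mulE; apply: (cof_mulA hR (b := elt y) (c := elt z)
  (x := elt (times x y)) (z := elt (times y z))).
- exact/mulE.
- exact/mulE.
- exact/mulE.
Qed.

Let timesC : commutative times.
Proof. by move=> x y; apply/mulE; apply: cof_mulC => //; apply/mulE. Qed.

Let times1 : left_id one times.
Proof.
move=> x; apply/esym/mulE; apply: cof_mulC => //.
exact: (cof_mul1 hR (elt_in x)).
Qed.

Let timesDl : left_distributive times plus.
Proof.
move=> x y z; rewrite !(timesC _ z); apply/addE.
apply: (cof_distr hR (a := elt z) (b := elt x) (c := elt y)
  (s := elt (plus x y))).
- exact/addE.
- exact/mulE.
- exact/mulE.
- exact/mulE.
Qed.

Let one_neq0 : one != zero.
Proof. by apply/eqP => /(congr1 elt); apply: cof_one_neq_zero hR. Qed.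

HB.instance Definition _ :=
  GRing.Zmodule_isComNzRing.Build RR timesA timesC times1 timesDl one_neq0.

Let mulVx x : x != 0%R -> times (inv x) x = one.
Proof. by rewrite timesC /inv => /eqP nz; case: cid => y /= [+ _]; apply. Qed.

Let inv0 : inv 0%R = 0%R.
Proof. by rewrite /inv; case: cid => y /= [_]; apply. Qed.

HB.instance Definition _ := GRing.ComNzRing_isField.Build RR mulVx inv0.

Import GRing.Theory.

Let leb_add2r x y z : leb x y -> leb (x + z)%R (y + z)%R.
Proof.
move=> /asboolP h; apply/asboolP; apply: (cof_le_add hR h (c := elt z));
  exact/addE.
Qed.

Let leb0_add x y : leb 0%R x -> leb 0%R y -> leb 0%R (x + y)%R.
Proof.
move=> hx hy; have := leb_add2r y hx; rewrite add0r => h.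
by apply/asboolP; apply: (cof_le_trans hR); apply/asboolP; eassumption.
Qed.

Let leb0_mul x y : leb 0%R x -> leb 0%R y -> leb 0%R (x * y)%R.
Proof.
move=> /asboolP hx /asboolP hy; apply/asboolP.
by apply: (cof_le_mul hR hx hy); apply/mulE.
Qed.

Let leb0_anti x : leb 0%R x -> leb x 0%R -> x = 0%R.
Proof.
by move=> /asboolP h /asboolP h'; apply: elt_inj; apply: (cof_le_antisym hR).
Qed.

Let leb_sub_ge0 x y : leb 0%R (y - x)%R = leb x y.
Proof.
apply/idP/idP => h; first by have := leb_add2r x h; rewrite add0r subrK.
by have := leb_add2r (- x)%R h; rewrite subrr.
Qed.

Let leb0_total x : leb 0%R x || leb x 0%R.
Proof.
apply/orP; have [h|h] := cof_le_total hR (elt_in 0%R) (elt_in x).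
  by left; apply/asboolP.
by right; apply/asboolP.
Qed.

Let norm x : RR := if leb 0%R x then x else (- x)%R.

Let lebN x : leb 0%R (- x)%R = leb x 0%R.
Proof. by rewrite -[RHS]leb_sub_ge0 sub0r. Qed.

Let normN x : norm (- x)%R = norm x.
Proof.
rewrite /norm lebN opprK; case: ifP; case: ifP => // h h'.
  by rewrite (leb0_anti h h') oppr0.
by have := leb0_total x; rewrite h h'.
Qed.

Let ge0_norm x : leb 0%R x -> norm x = x.
Proof. by rewrite /norm => ->. Qed.

HB.instance Definition _ := Num.IntegralDomain_isLeReal.Build RR
  leb0_add leb0_mul leb0_anti leb_sub_ge0 leb0_total normN ge0_norm
  (fun _ _ => erefl).

Lemma elt0 : elt 0%R = rzero R. Proof. by []. Qed.
Lemma elt1 : elt 1%R = rone R. Proof. by []. Qed.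

Lemma add_elt x y z : add R (elt x) (elt y) (elt z) <-> z = (x + y)%R.
Proof. exact: addE. Qed.

Lemma le_elt x y : le R (elt x) (elt y) <-> (x <= y)%R.
Proof. exact: (rwP (asboolP _)). Qed.

End RealField.
Arguments elt {V hV R hR} x : simpl never.

Import Order.TTheory GRing.Theory Num.Theory.
Local Open Scope ring_scope.

(** * Translation between relations of the model and arithmetic of the real field *)

Section RealNumbers.
Context (V : set_structure) (hV : ZF V) (R : real_data V)
  (hR : complete_ordered_field R).
Local Notation RR := (real hV hR).
Implicit Types x y z e r s t : RR.

Lemma lt_elt x y : lt R (elt x) (elt y) <-> x < y.
Proof.
rewrite /lt le_elt lt_neqAle; split=> [[-> h]|/andP[/eqP h ->]].
  by rewrite andbT; apply/eqP => E; apply: h; rewrite E.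
by split=> // /elt_inj.
Qed.

Lemma positive_elt x : positive R (elt x) <-> 0 < x.
Proof.
rewrite /positive -lt_elt elt0; split=> [[]//|h]; split=> //; exact: elt_in.
Qed.

Lemma positive_real (a : V) : positive R a -> exists x, a = elt x /\ 0 < x.
Proof.
move=> h; have [x Ex] := elt_surj hV hR h.1; subst.
by exists x; split=> //; apply/positive_elt.
Qed.

Lemma add_real x y (c : V) : add R (elt x) (elt y) c <-> c = elt (x + y).
Proof.
split=> [h|->]; last exact/add_elt.
have [_ _ cR] := maps2_dom (cof_add hR) h.
have [z Ez] := elt_surj hV hR cR; subst.
by move/add_elt: h => ->.
Qed.

(** Inside the model halving is expressed by addition alone, as [c + c = x]. *)
Lemma half_real x (c : V) : add R c c (elt x) <-> c = elt (x / 2).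
Proof.
split=> [h|->]; last by apply/add_elt; lra.
have [cR _ _] := maps2_dom (cof_add hR) h.
have [z Ez] := elt_surj hV hR cR; subst.
by move/add_elt: h => ->; congr (elt _); lra.
Qed.

Lemma close_elt x y e : close R (elt x) (elt y) (elt e) <-> `|x - y| < e.
Proof.
rewrite ltr_norml; split.
  move=> [s [t [/add_real -> [/lt_elt h [/add_real -> /lt_elt h']]]]].
  by apply/andP; split; lra.
move=> /andP[h h']; exists (elt (y + e)), (elt (x + e)).
by split; [exact/add_real|split; [apply/lt_elt; lra|split]];
  [exact/add_real|apply/lt_elt; lra].
Qed.

Definition to_R (a : V) : RR :=
  if pselect (a ∈ reals R) is left h then to_real hV hR h else 0.

Lemma to_RK a : a ∈ reals R -> elt (to_R a) = a.
Proof. by rewrite /to_R; case: pselect. Qed.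

(** Completeness concerns sets of the model only, whence the definability of [P]. *)
Lemma real_sup (P : V -> Prop) : definable 1 (fun rho => P (rho 0)) ->
  (exists x, P (elt x)) -> (exists u, forall x, P (elt x) -> x <= u) ->
  exists s, (forall x, P (elt x) -> x <= s) /\
    forall u, (forall x, P (elt x) -> x <= u) -> s <= u.
Proof.
move=> dP [x Px] [u hu].
have [S hS] : exists S, forall a, a ∈ S <-> a ∈ reals R /\ P a.
  by apply: separation.
have ub v : upper_bound R S (elt v) <-> forall x, P (elt x) -> x <= v.
  split=> [[_ h] y Py|h]; first by apply/le_elt/h/hS; split=> //; apply: elt_in.
  split=> [|a /hS[/(elt_surj hV hR)[y <-] Py]]; first exact: elt_in.
  exact/le_elt/h.
have [||| s [hs ls]] := cof_complete hR (S := S).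
- by move=> a /hS[].
- by exists (elt x); apply/hS; split=> //; apply: elt_in.
- by exists (elt u); apply/ub.
have [v Ev] := elt_surj hV hR hs.1; subst.
by exists v; split=> [|w /ub /ls /le_elt//]; apply/ub.
Qed.

(** Induction on [A] takes the minimum of two radii at each step, so that no function choosing a
    radius for each [a] is needed. *)
Lemma finite_radius (Q : V -> V -> Prop) (A : V) :
  definable 2 (fun rho => Q (rho 0%N) (rho 1%N)) -> is_finite A ->
  (forall (a : V) r s, a ∈ A -> 0 < r -> r <= s -> Q a (elt s) -> Q a (elt r)) ->
  (forall a : V, a ∈ A -> exists2 r : RR, 0 < r & Q a (elt r)) ->
  exists2 r : RR, 0 < r & forall a : V, a ∈ A -> Q a (elt r).
Proof.
move=> dQ fA mono ex.
(* The radius is an element [v] of the model here, which keeps the induction predicate definable. *)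
pose P B := incl B A ->
  exists v : V, positive R v /\ forall a : V, a ∈ B -> Q a v.
suff H : forall B, is_finite B -> P B.
  have [//|a [/positive_real[r [-> r0]] h]] := H A fA.
  by exists r.
apply: (finite_ind hV); rewrite /P; first by definable.
  move=> z hz _; exists (elt (1 : RR)); split; last by move=> a /hz.
  exact/positive_elt.
move=> B C y _ IH hC sC.
have [a aB|? [/positive_real[r [-> r0]] hr]] := IH; first by apply/sC/hC; left.
have [|s s0 hs] := ex y; first by apply/sC/hC; right.
exists (elt (Num.min r s)); split; first by apply/positive_elt; rewrite lt_min r0.
move=> a aC; have aA := sC a aC.
have m0 : 0 < Num.min r s by rewrite lt_min r0.
case/hC: aC => [aB|E].
  by apply: mono (hr a aB) => //; rewrite ge_min lexx.
by subst; apply: mono hs => //; rewrite ge_min lexx orbT.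
Qed.

End RealNumbers.

(** * The set of the powers of 1/2 *)

Section Dyadic.
Context (V : set_structure) (hV : ZF V) (R : real_data V)
  (hR : complete_ordered_field R).
Local Notation RR := (real hV hR).
Local Notation oneV := (elt (1 : RR)).
Implicit Types x y z e r s t : RR.

(* [E] is the set of all 2^-n. *)
Record is_dyadic (E : V) : Prop := IsDyadic {
  dyadic_real : incl E (reals R);
  dyadic1 : oneV ∈ E;
  dyadic_half : forall x, elt x ∈ E -> elt (x / 2) ∈ E;
  dyadic_min : forall G : V, oneV ∈ G ->
    (forall x, elt x ∈ E -> elt x ∈ G -> elt (x / 2) ∈ G) -> incl E G
}.

Lemma dyadic_exists : exists E, is_dyadic E.
Proof.
have [E hE] : exists E, forall v, v ∈ E <-> v ∈ reals R /\
    forall G, oneV ∈ G -> (forall a b, a ∈ G -> add R b b a -> b ∈ G) -> v ∈ G.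
  by apply: separation => //; definable.
exists E; split.
- by move=> v /hE[].
- by apply/hE; split; [exact: elt_in|].
- move=> x /hE[_ h]; apply/hE; split; first exact: elt_in.
  by move=> G G1 Gh; apply: (Gh (elt x)); [exact: h|apply/half_real].
- move=> G G1 Gh v vE; have [vR h] := (hE v).1 vE.
  (* Closure of [G] under halving is given at points of [E] only, so minimality is applied to the
     intersection of [G] and [E]. *)
  have [G' hG'] : exists G', forall v, v ∈ G' <-> v ∈ G /\ v ∈ E.
    by apply: separation => //; definable.
  suff /hG'[] : v ∈ G' by [].
  apply: h => [|a b /hG'[aG aE]].
    by apply/hG'; split=> //; apply/hE; split; [exact: elt_in|].
  have [aR ha] := (hE a).1 aE; have [x Ex] := elt_surj hV hR aR; subst.
  move/half_real => ->; apply/hG'; split; first exact: Gh.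
  apply/hE; split=> [|G2 G21 G2h]; first exact: elt_in.
  by apply: (G2h (elt x)); [exact: ha|apply/half_real].
Qed.

Context (E : V) (hE : is_dyadic E).

Lemma dyadic_ind (P : V -> Prop) : definable 1 (fun rho => P (rho 0%N)) ->
  P oneV -> (forall x, elt x ∈ E -> P (elt x) -> P (elt (x / 2))) ->
  forall x, elt x ∈ E -> P (elt x).
Proof.
move=> dP P1 Ph x xE.
have [G hG] : exists G, forall v, v ∈ G <-> v ∈ E /\ P v by apply: separation.
suff /hG[] : elt x ∈ G by [].
apply: (dyadic_min hE) xE; first by apply/hG; split=> //; apply: dyadic1.
move=> y yE /hG[_ Py]; apply/hG; split; first exact: dyadic_half.
exact: Ph.
Qed.

Lemma dyadic_elt (v : V) : v ∈ E -> exists x, v = elt x.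
Proof.
by move=> /(dyadic_real hE)/(elt_surj hV hR)[x <-]; exists x.
Qed.

Lemma dyadic_itv x : elt x ∈ E -> 0 < x <= 1.
Proof.
suff H : elt x ∈ E -> lt R (rzero R) (elt x) /\ le R (elt x) (rone R).
  by move=> /H[]; rewrite -(elt0 hV hR) -(elt1 hV hR) => /lt_elt -> /le_elt ->.
move: x; apply: (dyadic_ind
  (P := fun v => lt R (rzero R) v /\ le R v (rone R))).
- by definable.
- by rewrite -(elt0 hV hR) -(elt1 hV hR) lt_elt le_elt.
- move=> x _; rewrite -(elt0 hV hR) -(elt1 hV hR) !lt_elt !le_elt => -[h h'].
  split; lra.
Qed.

Lemma dyadic_gt0 x : elt x ∈ E -> 0 < x.
Proof. by move/dyadic_itv => /andP[]. Qed.

Lemma dyadic_le1 x : elt x ∈ E -> x <= 1.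
Proof. by move/dyadic_itv => /andP[]. Qed.

Lemma dyadic_inv x : elt x ∈ E -> x = 1 \/ elt (x + x) ∈ E.
Proof.
suff H : elt x ∈ E -> elt x = oneV \/ exists a, a ∈ E /\ add R (elt x) (elt x) a.
  move=> /H[/elt_inj|[a [aE /add_real Ea]]]; [by left|right].
  by rewrite -Ea.
move: x; apply: (dyadic_ind
  (P := fun v => v = oneV \/ exists a, a ∈ E /\ add R v v a)).
- by definable.
- by left.
- by move=> x xE _; right; exists (elt x); split=> //; apply/half_real.
Qed.

(** Induction on [x], applied to the double of [y]: if [y < x / 2], then [y + y < x], hence
    [y + y <= x / 2]. *)
Lemma dyadic_gap x y : elt x ∈ E -> elt y ∈ E -> y < x -> y <= x / 2.
Proof.
suff H : elt x ∈ E -> forall y : V, y ∈ E -> lt R y (elt x) ->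
    exists h, add R h h (elt x) /\ le R y h.
  move=> xE yE /lt_elt yx; have [h [/half_real ->]] := H xE _ yE yx.
  by move/le_elt.
move: x {y}; apply: (dyadic_ind (P := fun v => forall y : V, y ∈ E -> lt R y v ->
    exists h, add R h h v /\ le R y h)).
- by definable.
- move=> v /[dup] vE /dyadic_elt[y Ey]; subst=> /lt_elt lt_y1.
  exists (elt ((1 : RR) / 2)); split; first exact/half_real.
  apply/le_elt; have [?|/dyadic_le1 ?] := dyadic_inv vE; lra.
- move=> x xE IH v /[dup] vE /dyadic_elt[y Ey]; subst=> /lt_elt lt_yx.
  exists (elt (x / 2 / 2)); split; first exact/half_real.
  have [y1|yyE] := dyadic_inv vE; first by have := dyadic_le1 xE; lra.
  have [|h [/half_real -> /le_elt h']] := IH _ yyE; first by apply/lt_elt; lra.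
  apply/le_elt; lra.
Qed.

(** An Archimedean argument: if [r] were a lower bound of [E], the greatest lower bound [s] would be
    positive, but [s + s] is also a lower bound because [E] is closed under halving. *)
Lemma dyadic_small r : 0 < r -> exists x, elt x ∈ E /\ x < r.
Proof.
move=> r0; have [//|no] := pselect (exists x, elt x ∈ E /\ x < r).
have big x : elt x ∈ E -> r <= x.
  by move=> xE; rewrite leNgt; apply/negP => xr; apply: no; exists x.
have [||| s [hs ls]] := real_sup (hV := hV) (hR := hR)
    (P := fun v => v ∈ reals R /\ forall e : V, e ∈ E -> le R v e).
- by definable.
- exists r; split=> [|v /[dup] vE /dyadic_elt[x ?]]; first exact: elt_in.
  by subst; apply/le_elt/big.
- by exists 1 => x [_ /(_ _ (dyadic1 hE))/le_elt].
have s2 : s + s <= s.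
  apply: hs; split=> [|v /[dup] vE /dyadic_elt[x ?]]; first exact: elt_in.
  subst; apply/le_elt; suff : s <= x / 2 by lra.
  by apply: ls => y [_ h]; apply/le_elt/h/dyadic_half.
have : r <= s by apply: hs; split=> [|v /[dup] vE /dyadic_elt[x ?]];
  [exact: elt_in|subst; exact/le_elt/big].
lra.
Qed.

Lemma dyadic_finite r (B : V) : 0 < r ->
  (forall v : V, v ∈ B -> exists x, [/\ v = elt x, v ∈ E & r <= x]) ->
  is_finite B.
Proof.
(* The bound [r] is lowered to a power of 1/2, on which induction is possible. *)
move=> r0 hB; have [x [xE xr]] := dyadic_small r0.
suff H : elt x ∈ E -> forall B : V, (forall v, v ∈ B -> v ∈ E /\ le R (elt x) v) ->
    is_finite B.
  apply: H => // v /hB[y [-> yE ry]]; split=> //; apply/le_elt; lra.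
move: x {xE xr}; apply: (dyadic_ind
  (P := fun u => forall B, (forall v, v ∈ B -> v ∈ E /\ le R u v) -> is_finite B)).
- by definable.
- move=> C hC; apply: finite_subsingleton => //.
  have H a : a ∈ C -> a = oneV.
    move=> /hC[/[dup] aE /dyadic_elt[y ?]]; subst=> /le_elt.
    by have := dyadic_le1 aE => ? ?; congr elt; lra.
  by move=> a b /H-> /H->.
- move=> x xE IH C hC.
  have [C1 hC1] : exists C1, forall v, v ∈ C1 <-> v ∈ C /\ le R (elt x) v.
    by apply: separation => //; definable.
  have [C2 hC2] : exists C2, forall v, v ∈ C2 <-> v ∈ C /\ v = elt (x / 2).
    by apply: separation => //; definable.
  apply: (@finite_setU _ hV C1 C2).
  + by apply: IH => v /hC1[/hC[]].
  + by apply: finite_subsingleton => // a b /hC2[_ ->] /hC2[_ ->].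
  + move=> v; rewrite hC1 hC2; split=> [vC|[[]//|[]//]].
    have [/[dup] vE /dyadic_elt[y ?]] := hC v vC; subst=> /le_elt xy.
    (* By [dyadic_gap], lowering the bound from [x] to [x / 2] adds no power other than [x / 2]. *)
    have [yx|xy'] := ltP y x.
      by right; split=> //; congr elt; have := dyadic_gap xE vE yx; lra.
    by left; split=> //; apply/le_elt.
Qed.

(** Finitely many positive numbers have a positive lower bound, contrary to [dyadic_small]. *)
Lemma dyadic_infinite (B : V) : incl E B -> is_infinite B.
Proof.
move=> sEB fB; have fE := finite_sub hV fB sEB.
have [||v vE|r r0 hr] := finite_radius (hV := hV) (hR := hR)
    (Q := fun a b => le R b a) _ fE.
- by definable.
- move=> a r s /dyadic_elt[x ->] _ rs /le_elt sx; apply/le_elt; lra.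
- have [x ?] := dyadic_elt vE; subst; exists x; first exact: dyadic_gt0.
  exact/le_elt.
have [x [xE xr]] := dyadic_small r0.
have /le_elt := hr _ xE; lra.
Qed.

(** This provides canonical choices of indices. With [s] the supremum, some [y] satisfying [P]
    exceeds [s / 2]; by [dyadic_gap] a larger one would be at least [y + y] and so exceed [s]. *)
Lemma dyadic_max (P : V -> Prop) : definable 1 (fun rho => P (rho 0%N)) ->
  (exists e : V, e ∈ E /\ P e) ->
  exists e : V, [/\ e ∈ E, P e & forall e' : V, e' ∈ E -> P e' -> le R e' e].
Proof.
move=> dP [v [/[dup] vE /dyadic_elt[x ?]]]; subst=> Px.
have [||| s [hs ls]] := real_sup (hV := hV) (hR := hR)
    (P := fun v => v ∈ E /\ P v).
- by definable.
- by exists x.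
- by exists 1 => y [/dyadic_le1].
have xs : x <= s by exact: hs.
have x0 := dyadic_gt0 vE.
have [[y [yE Py ys]]|no] := pselect (exists y, [/\ elt y ∈ E, P (elt y) & s / 2 < y]).
  exists (elt y); split=> // e' /[dup] e'E /dyadic_elt[z ?]; subst=> Pz.
  apply/le_elt; rewrite leNgt; apply/negP => yz.
  have : z <= s by exact: hs.
  have := dyadic_gap e'E yE yz; lra.
have : s <= s / 2.
  apply: ls => y [yE Py]; rewrite leNgt; apply/negP => sy.
  by apply: no; exists y.
lra.
Qed.

End Dyadic.

(** * Countability of the powers of 1/2 and a criterion for cuf sets *)

Section Countable.
Context (V : set_structure) (hV : ZF V) (R : real_data V)
  (hR : complete_ordered_field R).
Local Notation RR := (real hV hR).
Local Notation oneV := (elt (1 : RR)).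
Implicit Types (x y : RR) (z e s n : V).

Lemma mem_asym (a b : V) : a ∈ b -> ~ b ∈ a.
Proof.
move=> ab ba; have [s hs] := ZF_pairing hV a b.
have [|v [/hs h hx]] := ZF_foundation hV (a := s).
  by exists a; apply/hs; left.
case: h => E; subst; first by apply: (hx b) => //; apply/hs; right.
by apply: (hx a) => //; apply/hs; left.
Qed.

Lemma is_succ_inj (n m k : V) : is_succ k n -> is_succ k m -> n = m.
Proof.
move=> hn hm; have /hm[nm|//] : n ∈ k by apply/hn; right.
have /hn[mn|//] : m ∈ k by apply/hm; right.
by case: (mem_asym nm mn).
Qed.

Lemma is_succ_nonempty (n k : V) : is_succ k n -> ~ is_empty k.
Proof. by move=> h /(_ n); apply; apply/h; right. Qed.

Context (E : V) (hE : is_dyadic hV hR E) (w : V) (hw : is_omega w).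

(* [h] maps 2^-n to n. *)
Lemma dyadic_index : exists h, is_fun h E w /\ injective_fun h.
Proof.
(* A relation is closed if it contains the pair of 1 and 0 and passes from [a], [n] to [a / 2],
   [n + 1]. Then [H] is the least closed relation. *)
pose closed G := (forall z : V, is_empty z -> maps G oneV z) /\
  forall a b n s : V, maps G a n -> add R b b a -> is_succ s n -> maps G b s.
have [H [_ hH]] : exists H, (forall p : V, p ∈ H ->
      exists a b, a ∈ E /\ b ∈ w /\ is_pair p a b) /\
    forall a n, maps H a n <-> a ∈ E /\ n ∈ w /\
      forall G, closed G -> maps G a n.
  by apply: (relation_exists hV (F := fun a n => forall G, closed G -> maps G a n));
     rewrite /closed; definable.
have H0 z : is_empty z -> maps H oneV z.
  move=> hz; apply/hH; split; first exact: dyadic1 hE.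
  split=> [|G [+ _]]; last exact.
  have [z' [hz' z'w]] := hw.1.1; suff -> : z = z' by [].
  by apply: set_ext => // v; split=> [/hz|/hz'].
have omegaS n s : n ∈ w -> is_succ s n -> s ∈ w.
  move=> nw hs; have [s' [hs' s'w]] := hw.1.2 n nw; suff -> : s = s' by [].
  by apply: set_ext => // v; rewrite hs hs'.
have HS x n s : maps H (elt x) n -> is_succ s n -> maps H (elt (x / 2)) s.
  move=> /hH[xE [nw h]] hs; apply/hH; split; first exact: dyadic_half hE _ _.
  split=> [|G hG]; first exact: omegaS hs.
  by apply: hG.2 (h G hG) _ hs; apply/half_real.
have H_inv x n : maps H (elt x) n -> (x = 1 /\ is_empty n) \/
    exists y m, [/\ maps H (elt y) m, x = y / 2 & is_succ n m].
  (* Inversion for [H]: the pairs of [H] that are the initial one or come from another pair of [H]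
     form a closed relation [G], so [H] is contained in [G] by minimality. *)
  have [G [_ hG]] : exists G, (forall p : V, p ∈ G ->
        exists a b, a ∈ E /\ b ∈ w /\ is_pair p a b) /\
      forall a n, maps G a n <-> a ∈ E /\ n ∈ w /\
        ((a = oneV /\ is_empty n) \/
         exists b m, maps H b m /\ add R a a b /\ is_succ n m) /\ maps H a n.
    by apply: (relation_exists hV (F := fun a n =>
        ((a = oneV /\ is_empty n) \/
         exists b m, maps H b m /\ add R a a b /\ is_succ n m) /\ maps H a n));
       definable.
  have cG : closed G.
    split=> [z hz|a b m s].
      have hz' := H0 z hz; have /hH[? [? _]] := hz'.
      by apply/hG; do 2!split=> //; split=> //; left.
    move=> /hG[aE [mw [_ Ham]]] hab hs.
    have [y ?] := dyadic_elt hE aE; subst; move/half_real: hab => ->.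
    have hs' := HS _ _ _ Ham hs; have /hH[? [? _]] := hs'.
    apply/hG; do 2!split=> //; split=> //; right; exists (elt y), m.
    by split=> //; split=> //; apply/half_real.
  move=> /hH[_ [_ /(_ _ cG)/hG[_ [_ [h _]]]]].
  case: h => [[/elt_inj ? ?]|[b [m [Hbm [/add_real hb hm]]]]]; first by left.
  right; exists (x + x), m; rewrite -hb; split=> //; lra.
have tot x : elt x ∈ E -> exists n, maps H (elt x) n.
  move: x; apply: (dyadic_ind hE (P := fun a => exists n, maps H a n)).
  - by definable.
  - by have [z hz] := set0_exists hV; exists z; apply: H0.
  - move=> x xE [n hn]; have [s hs] : exists s, is_succ s n := setU1_exists hV n n.
    by exists s; apply: HS hs.
have uniq x : elt x ∈ E -> forall n n', maps H (elt x) n -> maps H (elt x) n' ->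
    n = n'.
  move: x; apply: (dyadic_ind hE
    (P := fun a => forall n n', maps H a n -> maps H a n' -> n = n')).
  - by definable.
  - have one n : maps H oneV n -> is_empty n.
      move/H_inv => [[]//|[y [m [/hH[/(dyadic_le1 hE) y1 _] y2 _]]]]; lra.
    move=> n n' /one n0 /one n'0.
    by apply: set_ext => // v; split=> [/n0|/n'0].
  - move=> x xE IH n n' /H_inv[[x1 _]|[y [m [Hy yx hm]]]].
      by exfalso; have := dyadic_le1 hE xE; lra.
    move=> /H_inv[[x1 _]|[y' [m' [Hy' yx' hm']]]].
      by exfalso; have := dyadic_le1 hE xE; lra.
    have ? : y = x by lra.
    have ? : y' = x by lra.
    subst; have Em := IH _ _ Hy Hy'; subst.
    by apply: set_ext => // v; rewrite hm hm'.
have inj n : n ∈ w -> forall a b, maps H a n -> maps H b n -> a = b.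
  apply: (omega_ind hV (P := fun n => forall a b, maps H a n -> maps H b n -> a = b)
    hw); first by definable.
    have H1 z a : is_empty z -> maps H a z -> a = oneV.
      move=> hz /[dup] /hH[/(dyadic_elt hE)[x ->] _] /H_inv[[-> //]|].
      by move=> [y [m [_ _ /is_succ_nonempty]]].
    by move=> z hz a b /(H1 _ _ hz)-> /(H1 _ _ hz)->.
  move=> {}n s nw IH hs.
  have HSn a : maps H a s -> exists y, a = elt (y / 2) /\ maps H (elt y) n.
    move=> /[dup] /hH[/(dyadic_elt hE)[x ->] _] /H_inv[[_ /(is_succ_nonempty hs)//]|].
    move=> [y [m [Hy -> hm]]]; exists y.
    by rewrite (is_succ_inj hs hm).
  move=> a b /HSn[y [-> Hy]] /HSn[y' [-> Hy']].
  by rewrite (elt_inj (IH _ _ Hy Hy')).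
have [h [hf hh]] : exists h, is_fun h E w /\
    forall a, a ∈ E -> maps H a (app h a).
  apply: (fun_exists hV (F := fun a n => maps H a n)); first by definable.
    move=> a /[dup] aE /(dyadic_elt hE)[x ?]; subst.
    have [n hn] := tot x aE; exists n; split=> //.
    by move/hH: hn => [_ []].
  move=> a n n' /[dup] aE /(dyadic_elt hE)[x ?] _ _; subst; exact: uniq.
exists h; split=> // a b n han hbn.
have [aE nw] := maps_dom hf han; have [bE _] := maps_dom hf hbn.
by apply: (inj n) => //; [rewrite -(maps_eq hf han)|rewrite -(maps_eq hf hbn)];
   apply: hh.
Qed.

(** The pieces of [A] cut out by [K e] are finite and indexed by [E]. Different [e] may give the
    same piece, so a piece is sent to the index of the largest such [e]; this makes the family of
    pieces countable without choice. *)
Lemma is_cuf_dyadic (A : V) (K : V -> V -> Prop) :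
  definable 2 (fun rho => K (rho 0%N) (rho 1%N)) ->
  (forall e B : V, e ∈ E -> (forall v, v ∈ B -> v ∈ A /\ K e v) -> is_finite B) ->
  (forall v : V, v ∈ A -> exists e, e ∈ E /\ K e v) -> is_cuf A.
Proof.
move=> dK fK cK; have [PA hPA] := powerset_exists hV A.
pose piece S e := forall v : V, v ∈ S <-> v ∈ A /\ K e v.
have dpiece : definable 2 (fun rho => piece (rho 0%N) (rho 1%N)).
  by rewrite /piece; definable.
have [F hF] : exists F, forall S, S ∈ F <-> S ∈ PA /\ exists e, e ∈ E /\ piece S e.
  by apply: separation => //; definable.
have piece_ex e : exists S, piece S e.
  by apply: separation => //; definable.
have [h [hf hinj]] := dyadic_index.
exists F; split; [exists w|split].
- have [g [gf hg]] : exists g, is_fun g F w /\ forall S, S ∈ F -> exists e,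
      piece S e /\ (forall e', e' ∈ E -> piece S e' -> le R e' e) /\
      maps h e (app g S).
    apply: (fun_exists hV (F := fun S n => exists e,
      piece S e /\ (forall e', e' ∈ E -> piece S e' -> le R e' e) /\
      maps h e n)); first by definable.
      move=> S /hF[_ ex].
      have [|e [eE Se me]] := dyadic_max hE (P := piece S) _ ex.
        by rewrite /piece; definable.
      exists (app h e); split; first exact: app_in hf eE.
      by exists e; split=> //; split=> //; apply: maps_app hf eE.
    move=> S n n' _ _ _ [e [Se [me he]]] [e' [Se' [me' he']]].
    have [eE _] := maps_dom hf he; have [e'E _] := maps_dom hf he'.
    have Ee : e = e' by apply: (cof_le_antisym hR); [apply: me'|apply: me].
    by subst; rewrite -(maps_eq hf he) -(maps_eq hf he').
  exists g; do 2!split=> //.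
  move=> S S' n hS hS'; have [SF _] := maps_dom gf hS.
  have [S'F _] := maps_dom gf hS'.
  have [e [Se [_ he]]] := hg S SF; have [e' [Se' [_ he']]] := hg S' S'F.
  rewrite (maps_eq gf hS) in he; rewrite (maps_eq gf hS') in he'.
  have Ee := hinj _ _ _ he he'; subst.
  by apply: set_ext => // v; rewrite Se Se'.
- by move=> S /hF[_ [e [eE Se]]]; apply: (fK e) => // v /Se.
- move=> v; split=> [vA|[S [/hF[_ [e [_ Se]]] /Se[]//]]].
  have [e [eE Kev]] := cK v vA; have [S Se] := piece_ex e.
  exists S; split; last exact/Se.
  apply/hF; split; last by exists e.
  by apply/hPA => u /Se[].
Qed.

End Countable.

(** * Metric spaces *)

Section MetricSpaces.
Context (V : set_structure) (hV : ZF V) (R : real_data V)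
  (hR : complete_ordered_field R).
Local Notation RR := (real hV hR).
Implicit Types (eps delta : RR) (x y z a b d X T U : V).

Definition dist d x y : RR := to_R hV hR (app2 d x y).

Section FromMetric.
Context (X d : V) (hd : is_metric R X d).

Lemma maps2_dist x y : x ∈ X -> y ∈ X -> maps2 d x y (elt (dist d x y)).
Proof.
move=> xX yX; rewrite to_RK; first exact: (maps2_app2 hV (metric_fun hd) xX yX).
exact: (app2_in hV (metric_fun hd) xX yX).
Qed.

Lemma maps2_dist_inv x y a : maps2 d x y a ->
  [/\ x ∈ X, y ∈ X & a = elt (dist d x y)].
Proof.
move=> h; have [xX yX aR] := maps2_dom (metric_fun hd) h; split=> //.
by rewrite /dist (maps2_eq hV (metric_fun hd) h) to_RK.
Qed.

Lemma dist_ge0 x y : x ∈ X -> y ∈ X -> 0 <= dist d x y.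
Proof.
move=> xX yX; have := metric_ge0 hd (maps2_dist xX yX).
by rewrite -(elt0 hV hR) => /le_elt.
Qed.

Lemma dist_eq0 x y : x ∈ X -> y ∈ X -> dist d x y = 0 <-> x = y.
Proof.
move=> xX yX; rewrite -(metric_eq0 hd (maps2_dist xX yX)) -(elt0 hV hR).
by split=> [->//|/elt_inj].
Qed.

Lemma dist_sym x y : x ∈ X -> y ∈ X -> dist d x y = dist d y x.
Proof.
move=> xX yX.
by have /maps2_dist_inv[_ _ /elt_inj] := metric_sym hd (maps2_dist xX yX).
Qed.

Lemma dist_triangle y x z : x ∈ X -> y ∈ X -> z ∈ X ->
  dist d x z <= dist d x y + dist d y z.
Proof.
move=> xX yX zX; apply/le_elt.
apply: (metric_triangle hd (maps2_dist xX yX) (maps2_dist yX zX)).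
  exact: maps2_dist.
exact/add_elt.
Qed.

Lemma is_ball_dist b x eps : x ∈ X ->
  is_ball R b X d x (elt eps) <-> forall y, y ∈ b <-> y ∈ X /\ dist d x y < eps.
Proof.
move=> xX; have E y : (y ∈ X /\ exists a, maps2 d x y a /\ lt R a (elt eps)) <->
    y ∈ X /\ dist d x y < eps.
  split=> -[yX]; last first.
    move=> h; split=> //; exists (elt (dist d x y)).
    by split; [exact: maps2_dist|apply/lt_elt].
  by move=> [a [/maps2_dist_inv[_ _ ->] /lt_elt]].
by split=> h y; rewrite h E.
Qed.

Lemma ball_exists x eps : x ∈ X ->
  exists b, forall y, y ∈ b <-> y ∈ X /\ dist d x y < eps.
Proof.
move=> xX; suff [b hb] : exists b, is_ball R b X d x (elt eps).
  by exists b; apply/is_ball_dist.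
by apply: separation => //; definable.
Qed.

Lemma ball_nbhs U x : x ∈ X ->
  (exists e b, positive R e /\ is_ball R b X d x e /\ incl b U) <->
  exists2 eps : RR, 0 < eps & forall y, y ∈ X -> dist d x y < eps -> y ∈ U.
Proof.
move=> xX; split=> [[e [b [/(positive_real hV hR)[eps [-> e0]] [hb sbU]]]]|].
  exists eps => // y yX h; apply: sbU.
  by apply/((is_ball_dist b eps xX).1 hb).
move=> [eps e0 h]; have [b hb] := ball_exists eps xX.
exists (elt eps), b; split; first exact/positive_elt.
by split; [apply/is_ball_dist|move=> y /hb[]; exact: h].
Qed.

Lemma metric_topologyP T : is_metric_topology R T X d <->
  forall U, U ∈ T <-> incl U X /\ forall x, x ∈ U ->
    exists2 eps : RR, 0 < eps & forall y, y ∈ X -> dist d x y < eps -> y ∈ U.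
Proof.
split=> hT U; rewrite (hT U); split=> -[sUX h]; split=> // x xU;
  by apply/ball_nbhs; [exact: sUX|exact: h].
Qed.

Lemma ball_open T b x eps : is_metric_topology R T X d -> x ∈ X ->
  (forall y, y ∈ b <-> y ∈ X /\ dist d x y < eps) -> b ∈ T.
Proof.
move=> /metric_topologyP hT xX hb; apply/hT; split=> [y /hb[]//|y /hb[yX yx]].
exists (eps - dist d x y) => [|z zX h]; first lra.
by apply/hb; split=> //; have := dist_triangle xX yX zX; lra.
Qed.

End FromMetric.

Lemma is_metric_dist X d : is_fun2 d X X (reals R) ->
  (forall x y, x ∈ X -> y ∈ X -> 0 <= dist d x y) ->
  (forall x y, x ∈ X -> y ∈ X -> dist d x y = 0 <-> x = y) ->
  (forall x y, x ∈ X -> y ∈ X -> dist d x y = dist d y x) ->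
  (forall x y z, x ∈ X -> y ∈ X -> z ∈ X ->
    dist d x z <= dist d x y + dist d y z) ->
  is_metric R X d.
Proof.
move=> fd d0 deq dsym dtri.
have dP x y a : maps2 d x y a -> [/\ x ∈ X, y ∈ X & a = elt (dist d x y)].
  move=> h; have [xX yX aR] := maps2_dom fd h; split=> //.
  by rewrite /dist (maps2_eq hV fd h) to_RK.
split=> //.
- by move=> x y a /dP[xX yX ->]; rewrite -(elt0 hV hR); apply/le_elt/d0.
- move=> x y a /dP[xX yX ->]; rewrite -(elt0 hV hR) -(deq x y) //.
  by split=> [/elt_inj|->].
- move=> x y a /dP[xX yX ->]; rewrite dsym // to_RK.
    exact: (maps2_app2 hV fd yX xX).
  exact: (app2_in hV fd yX xX).
- move=> x y z a b c u /dP[xX yX ->] /dP[_ zX ->] /dP[_ _ ->] /add_real ->.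
  exact/le_elt/dtri.
Qed.

(** The two epsilon-delta conditions give continuity of [f] and of its inverse on the image. The
    second, with [eps] the distance of [x] and [y], also gives injectivity. *)
Lemma metric_embedding X d T C rho TC f :
  is_metric R X d -> is_metric_topology R T X d ->
  is_metric R C rho -> is_metric_topology R TC C rho -> is_fun f X C ->
  (forall x eps, x ∈ X -> 0 < eps -> exists2 delta : RR, 0 < delta &
    forall y, y ∈ X -> dist d x y < delta ->
      dist rho (app f x) (app f y) < eps) ->
  (forall x eps, x ∈ X -> 0 < eps -> exists2 delta : RR, 0 < delta &
    forall y, y ∈ X -> dist rho (app f x) (app f y) < delta ->
      dist d x y < eps) ->
  is_embedding f X T C TC.
Proof.
move=> hd /(metric_topologyP hd) hT hrho /[dup] mTC /(metric_topologyP hrho) hTC.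
move=> ff cont inv.
have fC x : x ∈ X -> app f x ∈ C by apply: app_in.
have finj x y : x ∈ X -> y ∈ X -> app f x = app f y -> x = y.
  move=> xX yX E; apply: contrapT => xy.
  have d0 : 0 < dist d x y.
    by rewrite lt_neqAle eq_sym (dist_ge0 hd) // andbT; apply/eqP => /(dist_eq0 hd xX yX).
  have [delta delta0 h] := inv x _ xX d0.
  suff : dist d x y < dist d x y by rewrite ltxx.
  by apply: h => //; rewrite -E (dist_eq0 hrho _ _).2 //; apply: fC.
have [Z hZ] : exists Z, forall y, y ∈ Z <-> y ∈ C /\ exists x, x ∈ X /\ maps f x y.
  by apply: separation => //; definable.
have fZ x : x ∈ X -> app f x ∈ Z.
  move=> xX; apply/hZ; split; first exact: fC.
  by exists x; split=> //; apply: maps_app ff xX.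
have Zf y : y ∈ Z -> exists2 x, x ∈ X & y = app f x.
  by move=> /hZ[_ [x [xX h]]]; exists x => //; rewrite (maps_eq ff h).
have [PZ hPZ] := powerset_exists hV Z.
have [TZ hTZ] : exists TZ, forall W, W ∈ TZ <-> W ∈ PZ /\
    exists U, U ∈ TC /\ forall y, y ∈ W <-> y ∈ U /\ y ∈ Z.
  by apply: separation => //; definable.
split=> //; exists Z, TZ; split.
  move=> y; rewrite hZ; split=> [[]//|h]; split=> //.
  by have [x [_ h']] := h; have [] := maps_dom ff h'.
split.
  move=> W; rewrite hTZ; split=> [[]//|h]; split=> //.
  by apply/hPZ => y; have [U [_ ->]] := h => -[].
split; [split; [split|split]|split].
- move=> p pf; have [x [y [xX [yC hp]]]] := ff.1 p pf.
  exists x, y; split=> //; split=> //; suff <- : app f x = y by apply: fZ.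
  by apply: (maps_eq ff); exists p.
- exact: ff.2.
- move=> x y c h h'; have [xX _] := maps_dom ff h; have [yX _] := maps_dom ff h'.
  by apply: finj => //; rewrite (maps_eq ff h) (maps_eq ff h').
- by move=> y /Zf[x xX ->]; exists x; split=> //; apply: maps_app ff xX.
- move=> W U /hTZ[_ [O [/hTC[sOC hO] hW]]] hU; apply/hT.
  split=> [x /hU[]//|x /hU[xX [y [/hW[yO yZ] h]]]].
  rewrite -(maps_eq ff h) in yO; have [eps eps0 he] := hO _ yO.
  have [delta delta0 hdelta] := cont x eps xX eps0; exists delta => // z zX xz.
  apply/hU; split=> //; exists (app f z); split; last exact: maps_app ff zX.
  by apply/hW; split; [apply: he; [exact: fC|exact: hdelta]|exact: fZ].
- move=> U W /hT[sUX hU] hW; apply/hTZ; split.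
    apply/hPZ => y /hW[x [/sUX xX h]]; rewrite -(maps_eq ff h); exact: fZ.
  (* [O] is the union of all open sets whose trace on [Z] lies in [W], so no radius has to be chosen
     at each point of [W]. *)
  have [O hO] : exists O, forall y, y ∈ O <-> y ∈ C /\ exists b, b ∈ TC /\
      y ∈ b /\ forall z, z ∈ b -> z ∈ Z -> z ∈ W.
    by apply: separation => //; definable.
  exists O; split.
    apply/hTC; split=> [y /hO[]//|y /hO[yC [b [bTC [yb hb]]]]].
    have [_ /(_ y yb)[eps eps0 h]] := (hTC b).1 bTC; exists eps => // z zC yz.
    by apply/hO; split=> //; exists b; split=> //; split=> //; apply: h.
  move=> y; split=> [yW|[/hO[_ [b [_ [yb hb]]]] yZ]]; last exact: hb.
  have [x [xU hx]] := (hW y).1 yW; have xX := sUX x xU.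
  have Ey := maps_eq ff hx; subst.
  split; last exact: fZ.
  have [eps eps0 he] := hU x xU; have [delta delta0 hdelta] := inv x eps xX eps0.
  have [b hb] := ball_exists hrho delta (fC x xX).
  apply/hO; split; first exact: fC.
  exists b; split; first exact: (ball_open hrho mTC (fC x xX) hb).
  split.
    apply/hb; split; first exact: fC.
    by rewrite (dist_eq0 hrho (fC x xX) (fC x xX)).2.
  move=> z /hb[_ xz] /Zf[u uX Eu]; subst; apply/hW; exists u.
  by split; [apply: he => //; apply: hdelta|apply: maps_app ff uX].
Qed.

End MetricSpaces.

(** * Isolation radii and the metric of the cube *)

Section IsolationRadius.
Context (V : set_structure) (hV : ZF V) (R : real_data V)
  (hR : complete_ordered_field R).
Local Notation RR := (real hV hR).
Local Notation dist := (dist hV hR).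
Implicit Types (eps delta : RR) (x y z a b d X T U : V).

(** The ball about [x] of radius [a] contains no other point; [a] ranges over the model to keep this
    definable. *)
Definition iso_radius d x a := forall y b, maps2 d x y b -> lt R b a -> y = x.

Lemma definable_iso_radius d :
  definable 2 (fun rho => iso_radius d (rho 0%N) (rho 1%N)).
Proof. by rewrite /iso_radius; definable. Qed.

Context (X d T : V) (hd : is_metric R X d) (hT : is_metric_topology R T X d).

Lemma iso_radiusP x eps : x ∈ X ->
  iso_radius d x (elt eps) <-> forall y, y ∈ X -> dist d x y < eps -> y = x.
Proof.
move=> xX; split=> h y.
  by move=> yX /lt_elt; apply: h; apply: (maps2_dist hV hR hd xX yX).
by move=> b /(maps2_dist_inv hV hR hd)[_ yX ->] /lt_elt; apply: h.
Qed.

Lemma iso_radius_le x eps delta : x ∈ X -> eps <= delta ->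
  iso_radius d x (elt delta) -> iso_radius d x (elt eps).
Proof.
move=> xX ed /(iso_radiusP _ xX) h; apply/iso_radiusP => // y yX xy.
by apply: h => //; lra.
Qed.

Lemma isolated_iso_radius x : x ∈ X -> isolated T x ->
  exists2 eps : RR, 0 < eps & iso_radius d x (elt eps).
Proof.
move=> xX [s [hs]] /((metric_topologyP hV hR hd T).1 hT)[_ /(_ x)].
case; first by apply/hs; left.
move=> eps eps0 h; exists eps => //; apply/iso_radiusP => // y yX /(h _ yX).
by move=> /hs[].
Qed.

Lemma totally_bounded_iso_finite eps B : totally_bounded R X d -> 0 < eps ->
  (forall x, x ∈ B -> x ∈ X /\ iso_radius d x (elt eps)) -> is_finite B.
Proof.
move=> tb eps0 hB; have [|F [fF [Fball Fcov]]] := tb (elt (eps / 2)).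
  apply/positive_elt; lra.
(* Membership maps balls of the cover to points of [B]: two points of [B] in one ball of radius
   [eps / 2] are less than [eps] apart, hence equal. *)
apply: (finite_image hV (F := fun b y => y ∈ b) _ fF).
- by definable.
- move=> b x y bF /hB[xX hx] /hB[yX _] xb yb; apply/esym.
  have [c [cX hb]] := Fball b bF; have {}hb := (is_ball_dist hd b _ cX).1 hb.
  move/(iso_radiusP _ xX): hx; apply=> //.
  have [_ h1] := (hb _).1 xb; have [_ h2] := (hb _).1 yb.
  have := dist_triangle hV hR hd xX cX yX; rewrite (dist_sym hV hR hd xX cX); lra.
- by move=> y /hB[/Fcov[b [bF yb]] _]; exists b.
Qed.

Lemma limit_point_compact_iso_finite eps B : limit_point_compact X T -> 0 < eps ->
  (forall x, x ∈ B -> x ∈ X /\ iso_radius d x (elt eps)) -> is_finite B.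
Proof.
move=> lpc eps0 hB; apply: contrapT => infB.
have [|x [xX acc]] := lpc B _ infB; first by move=> y /hB[].
have near delta : 0 < delta -> exists y, [/\ y ∈ B, y <> x & dist d x y < delta].
  move=> delta0; have [b hb] := ball_exists hd delta xX.
  have [||y [/hb[yX xy] [yB yx]]] := acc b; last by exists y.
    exact: (ball_open hd hT xX hb).
  by apply/hb; split=> //; rewrite (dist_eq0 hV hR hd xX xX).2.
have [|y [yB yx xy]] := near (eps / 2); first lra.
have [yX hy] := hB y yB.
have d0 : 0 < dist d x y.
  rewrite lt_neqAle eq_sym (dist_ge0 hV hR hd) // andbT.
  by apply/eqP => /(dist_eq0 hV hR hd xX yX) E; apply: yx.
(* A second point [z] of [B] strictly closer to [x] than [y] differs from [y], yet lies within [eps]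
   of it. *)
have [|z [zB zx]] := near (Num.min (dist d x y) (eps / 2)).
  by rewrite lt_min d0; lra.
rewrite lt_min => /andP[xz xz']; have [zX _] := hB z zB.
suff E : z = y by subst; rewrite ltxx in xz.
move/(iso_radiusP _ yX): hy; apply=> //.
by have := dist_triangle hV hR hd yX xX zX; rewrite (dist_sym hV hR hd yX xX); lra.
Qed.

End IsolationRadius.

(** * Metrization of the cube from weights on its coordinates *)

Section Cube.
Context (V : set_structure) (hV : ZF V) (R : real_data V)
  (hR : complete_ordered_field R).
Local Notation RR := (real hV hR).
Local Notation dist := (dist hV hR).
Implicit Types (r eps delta : RR) (f g h j x y z a b J I C U : V).

Definition proj f j : RR := to_R hV hR (app f j).

Context (J I TI C TC : V) (hI : is_unit_interval R I)
  (hTI : is_usual_topology R I TI) (hC : is_power C J I)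
  (hTC : is_product_topology C J TI TC).

Lemma coord_elt f j : f ∈ C -> j ∈ J -> elt (proj f j) = app f j.
Proof.
move=> /hC ff jJ; apply: to_RK.
by have /hI[] := app_in ff jJ.
Qed.

Lemma maps_coord f j : f ∈ C -> j ∈ J -> maps f j (elt (proj f j)).
Proof. by move=> fC jJ; rewrite coord_elt //; apply: maps_app (proj1 (hC f) fC) jJ. Qed.

Lemma maps_coord_inv f j a : f ∈ C -> maps f j a -> j ∈ J /\ a = elt (proj f j).
Proof.
move=> fC h; have [jJ _] := maps_dom ((hC f).1 fC) h; split=> //.
by rewrite coord_elt // (maps_eq ((hC f).1 fC) h).
Qed.

Lemma coord_ext f g : f ∈ C -> g ∈ C ->
  (forall j, j ∈ J -> proj f j = proj g j) -> f = g.
Proof.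
move=> fC gC E; apply: (fun_ext hV ((hC f).1 fC) ((hC g).1 gC)) => j jJ.
by rewrite -!coord_elt // E.
Qed.

(* [K j r] says that the weight of the coordinate [j] is at least [r]. *)
Context (K : V -> V -> Prop) (dK : definable 2 (fun rho => K (rho 0%N) (rho 1%N))).
Context (K_le : forall j r eps, j ∈ J -> 0 < r -> r <= eps ->
  K j (elt eps) -> K j (elt r)).
Context (K_ex : forall j, j ∈ J -> exists2 r : RR, 0 < r <= 1 & K j (elt r)).
(** This takes the place of countability of the index set in the usual metrization of a product: a
    ball constrains only finitely many coordinates. *)
Context (K_finite : forall r B, 0 < r ->
  (forall j, j ∈ B -> j ∈ J /\ K j (elt r)) -> is_finite B).

(* The distance from [f] to [g] will be the supremum of these [a]. *)
Definition separated f g a := a = rzero R \/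
  (positive R a /\ le R a (rone R) /\ exists j, K j a /\
   exists u v, maps f j u /\ maps g j v /\ ~ close R u v a).

Lemma separatedP f g r : f ∈ C -> g ∈ C -> separated f g (elt r) <->
  r = 0 \/ [/\ 0 < r, r <= 1 & exists j,
    [/\ j ∈ J, K j (elt r) & r <= `|proj f j - proj g j|]].
Proof.
move=> fC gC; rewrite /separated -(elt0 hV hR) -(elt1 hV hR) positive_elt le_elt.
split.
  case=> [/elt_inj|[r0 [r1 [j [Kj [u [v [hu [hv nc]]]]]]]]]; first by left.
  have [jJ ?] := maps_coord_inv fC hu; have [_ ?] := maps_coord_inv gC hv; subst.
  right; split=> //; exists j; split=> //; rewrite leNgt.
  by apply/negP => /close_elt.
case=> [->|[r0 r1 [j [jJ Kj h]]]]; first by left.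
right; split=> //; split=> //; exists j; split=> //.
exists (elt (proj f j)), (elt (proj g j)).
split; first exact: maps_coord.
split; first exact: maps_coord.
by move=> /close_elt; lra.
Qed.

(** The set of separating numbers contains 0 and is bounded by 1; its least upper bound is unique,
    so the metric is a function of the model without choice. *)
Lemma cube_metric_exists : exists rho, is_fun2 rho C C (reals R) /\
  forall f g, f ∈ C -> g ∈ C ->
    (forall r, separated f g (elt r) -> r <= dist rho f g) /\
    (forall eps, (forall r, separated f g (elt r) -> r <= eps) ->
      dist rho f g <= eps).
Proof.
pose lub f g a := (forall b, separated f g b -> le R b a) /\
  forall u, u ∈ reals R -> (forall b, separated f g b -> le R b u) -> le R a u.
have sep_real f g a : separated f g a -> exists r, a = elt r.
  case=> [->|[[aR _] _]]; first by exists 0.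
  by have [r <-] := elt_surj hV hR aR; exists r.
have lubP f g r : lub f g (elt r) <->
    (forall eps, separated f g (elt eps) -> eps <= r) /\
    forall eps, (forall delta, separated f g (elt delta) -> delta <= eps) ->
      r <= eps.
  split=> -[h1 h2]; split.
  - by move=> eps /h1/le_elt.
  - move=> eps he; apply/le_elt/h2; first exact: elt_in.
    by move=> b /[dup] /sep_real[delta ->] /he ?; apply/le_elt.
  - by move=> b /[dup] /sep_real[delta ->] /h1 ?; apply/le_elt.
  - move=> u /(elt_surj hV hR)[eps <-] hu; apply/le_elt/h2 => delta.
    by move=> /hu/le_elt.
have [rho [frho hrho]] : exists rho, is_fun2 rho C C (reals R) /\
    forall f g, f ∈ C -> g ∈ C -> lub f g (app2 rho f g).
  apply: (fun2_exists hV (F := lub)).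
  - by rewrite /lub /separated; definable.
  - move=> f g fC gC.
    have [||| s [hs ls]] := real_sup (hV := hV) (hR := hR) (P := separated f g).
    + by rewrite /separated; definable.
    + by exists 0; left.
    + by exists 1 => r /separatedP[]// => [->|[]].
    by exists (elt s); split; [exact: elt_in|apply/lubP].
  - move=> f g a b _ _ aR bR [h1 h2] [h1' h2'].
    by apply: (cof_le_antisym hR); [apply: h2|apply: h2'].
exists rho; split=> // f g fC gC; apply/lubP; rewrite to_RK; first exact: hrho.
exact: (app2_in hV frho fC gC).
Qed.

(** The last two conclusions serve the embedding: uniform closeness of coordinates bounds [rho], and
    a small [rho] controls each coordinate up to its weight. *)
Lemma cube_metrizable : exists rho,
  [/\ is_metric R C rho, is_metric_topology R TC C rho,
   forall f g r, f ∈ C -> g ∈ C -> 0 <= r ->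
     (forall j, j ∈ J -> `|proj f j - proj g j| <= r) -> dist rho f g <= r &
   forall f g j r, f ∈ C -> g ∈ C -> j ∈ J -> 0 < r -> r <= 1 -> K j (elt r) ->
     dist rho f g < r -> `|proj f j - proj g j| < r].
Proof.
have [rho [frho hrho]] := cube_metric_exists; exists rho.
have sep_le f g r : f ∈ C -> g ∈ C -> separated f g (elt r) -> r <= dist rho f g.
  by move=> fC gC; apply: (hrho f g fC gC).1.
have le_sep f g eps : f ∈ C -> g ∈ C -> 0 <= eps ->
    (forall r j, 0 < r -> r <= 1 -> j ∈ J -> K j (elt r) ->
      r <= `|proj f j - proj g j| -> r <= eps) -> dist rho f g <= eps.
  move=> fC gC e0 h; apply: (hrho f g fC gC).2 => r /separatedP[]// => [->//|].
  by move=> [r0 r1 [j [jJ Kj hj]]]; apply: h hj.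
have rho0 f g : f ∈ C -> g ∈ C -> 0 <= dist rho f g.
  by move=> fC gC; apply: sep_le => //; left.
(* The basic lower bound for [rho]; the minimum inherits weight [K j] from [r] because [K] is
   monotone. *)
have sep_min f g j r : f ∈ C -> g ∈ C -> j ∈ J -> 0 < r -> r <= 1 ->
    K j (elt r) -> Num.min r `|proj f j - proj g j| <= dist rho f g.
  move=> fC gC jJ r0 r1 Kj; have [m0|m0] := ltP 0 (Num.min r `|proj f j - proj g j|).
    apply: sep_le => //; apply/separatedP => //; right; split=> //.
      by rewrite ge_min r1.
    exists j; split=> //; last by rewrite ge_min lexx orbT.
    by apply: K_le Kj => //; rewrite ge_min lexx.
  by apply: le_trans m0 _; apply: rho0.
have lipschitz f g r : f ∈ C -> g ∈ C -> 0 <= r ->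
     (forall j, j ∈ J -> `|proj f j - proj g j| <= r) -> dist rho f g <= r.
  by move=> fC gC r0 h; apply: le_sep => // s j _ _ jJ _ /le_trans; apply; apply: h.
have coord_lt f g j r : f ∈ C -> g ∈ C -> j ∈ J -> 0 < r -> r <= 1 ->
    K j (elt r) -> dist rho f g < r -> `|proj f j - proj g j| < r.
  move=> fC gC jJ r0 r1 Kj hr; rewrite ltNge; apply/negP => hc.
  by have := sep_min f g j r fC gC jJ r0 r1 Kj; rewrite min_l //; lra.
have mrho : is_metric R C rho.
  apply: (is_metric_dist (hV := hV) (hR := hR)) => //.
  - move=> f g fC gC; split=> [E|->]; last first.
      apply/le_anti; rewrite rho0 // andbT; apply: lipschitz => // j _.
      by rewrite subrr normr0.
    apply: coord_ext => // j jJ; have [r /andP[r0 r1] Kj] := K_ex jJ.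
    have := sep_min f g j r fC gC jJ r0 r1 Kj.
    rewrite E ge_min leNgt r0 /= normr_le0 subr_eq0 => /eqP//.
  - suff H f g : f ∈ C -> g ∈ C -> dist rho f g <= dist rho g f.
      by move=> f g fC gC; apply/le_anti; rewrite !H.
    move=> fC gC; apply: le_sep => [|//||r j r0 r1 jJ Kj h]; rewrite ?rho0 //.
    have := sep_min g f j r gC fC jJ r0 r1 Kj.
    by rewrite min_l // distrC.
  - move=> f g h fC gC hC'; apply: le_sep => //.
      by rewrite addr_ge0 ?rho0.
    (* If the coordinates of [f] and [h] at [j] are at least [r] apart, the two distances through
       [g], each truncated at [r], still add up to at least [r]. *)
    move=> r j r0 r1 jJ Kj hr.
    have := sep_min f g j r fC gC jJ r0 r1 Kj.
    have := sep_min g h j r gC hC' jJ r0 r1 Kj.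
    have := ler_distD (proj g j) (proj f j) (proj h j).
    have := normr_ge0 (proj f j - proj g j).
    have := normr_ge0 (proj g j - proj h j).
    by rewrite !minEle; case: ifP => _; case: ifP => _; lra.
split=> //; apply/(metric_topologyP hV hR mrho) => U; split.
- move=> /hTC[sUC hU]; split=> // f fU; have fC := sUC f fU.
  have [F [fF [hF FU]]] := hU f fU.
  (* The predicate says that the ball of radius [a] about [f] lies in [W]; one radius is wanted for
     all of [F]. *)
  have [|||r r0 hr] := finite_radius (hV := hV) (hR := hR)
    (Q := fun W a => forall g, g ∈ C -> forall b, maps2 rho f g b ->
      lt R b a -> g ∈ W) _ fF.
  + by definable.
  + move=> W r s _ r0 rs h g gC b /(maps2_dist_inv hV hR mrho)[_ _ ->] /lt_elt hb.
    apply: (h g gC); first exact: (maps2_dist hV hR mrho fC gC).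
    by apply/lt_elt; lra.
  + move=> W WF; have [[j [O [jJ [OT hW]]]] fW] := hF W WF.
    have [_ [y [yO hy]]] := (hW f).1 fW.
    have [_ ?] := maps_coord_inv fC hy; subst.
    have [_ /(_ _ yO)[e [/(positive_real hV hR)[eps [-> eps0]] he]]] := (hTI O).1 OT.
    have [r /andP[r0 r1] Kj] := K_ex jJ.
    have m0 : 0 < Num.min r eps by rewrite lt_min r0.
    have m1 : Num.min r eps <= 1 by rewrite ge_min r1.
    have Km : K j (elt (Num.min r eps)) by apply: K_le Kj => //; rewrite ge_min lexx.
    exists (Num.min r eps) => // g gC b /(maps2_dist_inv hV hR mrho)[_ _ ->].
    move=> /lt_elt hb; apply/hW; split=> //; exists (elt (proj g j)).
    split; last exact: maps_coord.
    apply: he; first by rewrite coord_elt //; apply: app_in ((hC g).1 gC) jJ.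
    apply/close_elt; have := coord_lt f g j _ fC gC jJ m0 m1 Km hb.
    by rewrite lt_min => /andP[].
  exists r => // g gC fg; apply: FU => // W WF.
  by apply: (hr W WF) => //; [exact: (maps2_dist hV hR mrho fC gC)|apply/lt_elt].
- move=> [sUC hU]; apply/hTC; split=> // f fU; have fC := sUC f fU.
  have [eps eps0 he] := hU f fU.
  (* The coordinates of weight at least [r] form a finite set [A]. If [g] is [r]-close to [f] on
     [A], then [rho f g <= r], which is strictly below [eps]. *)
  pose r := Num.min (eps / 2) 1.
  have r0 : 0 < r by rewrite /r lt_min ltr01 andbT; lra.
  have r1 : r <= 1 by rewrite /r ge_min lexx orbT.
  have re : r < eps by rewrite /r gt_min; apply/orP; left; lra.
  have [A hA] : exists A, forall j, j ∈ A <-> j ∈ J /\ K j (elt r).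
    by apply: separation => //; definable.
  have fA : is_finite A by apply: (K_finite r0) => j /hA.
  (* [W] is the subbasic neighbourhood of [f] that restricts coordinate [j] to distance less than
     [r]; [F] is the image of [A] under this assignment. *)
  pose nbhs j W := forall g, g ∈ W <-> g ∈ C /\
    exists u v, maps f j u /\ maps g j v /\ close R u v (elt r).
  have nbhsP j W : j ∈ J -> nbhs j W -> forall g, g ∈ W <-> g ∈ C /\
      `|proj f j - proj g j| < r.
    move=> jJ hW g; rewrite hW; split=> -[gC].
      move=> [u [v [hu [hv /[dup] huv]]]].
      have [_ ->] := maps_coord_inv fC hu; have [_ ->] := maps_coord_inv gC hv.
      by move=> /close_elt.
    move=> h; split=> //; exists (elt (proj f j)), (elt (proj g j)).
    by do 2!(split; first exact: maps_coord); apply/close_elt.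
  have [PC hPC] := powerset_exists hV C.
  have [F hF] : exists F, forall W, W ∈ F <-> W ∈ PC /\ exists j, j ∈ A /\ nbhs j W.
    by apply: separation => //; rewrite /nbhs; definable.
  exists F; split; [|split].
  + apply: (finite_image hV (F := nbhs) _ fA).
    * by rewrite /nbhs; definable.
    * by move=> j W W' _ _ _ h h'; apply: set_ext => // g; rewrite h h'.
    * by move=> W /hF[].
  + move=> W /hF[_ [j [/hA[jJ Kj] hW]]]; have {}hW := nbhsP j W jJ hW.
    split; last by apply/hW; split=> //; rewrite subrr normr0.
    have [O hO] : exists O, forall y, y ∈ O <-> y ∈ I /\
        close R (elt (proj f j)) y (elt r).
      by apply: separation => //; definable.
    have I_real y : y ∈ I -> exists s : RR, y = elt s.
      by move=> /hI[/(elt_surj hV hR)[s <-] _]; exists s.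
    exists j, O; split=> //; split.
      apply/hTI; split=> [y /hO[]//|y /hO[/[dup] yI /I_real[s ?]]]; subst.
      move=> /close_elt hs; exists (elt (r - `|proj f j - s|)).
      split; first by apply/positive_elt; lra.
      move=> z zI; have [t ?] := I_real z zI; subst=> /close_elt hz.
      apply/hO; split=> //; apply/close_elt.
      by have := ler_distD s (proj f j) t; lra.
    move=> g; rewrite hW; split=> -[gC].
      move=> h; split=> //; exists (elt (proj g j)); split; last exact: maps_coord.
      apply/hO; split; last exact/close_elt.
      by rewrite coord_elt //; apply: app_in ((hC g).1 gC) jJ.
    move=> [y [/hO[_ hy] hg]]; split=> //; have [_ ?] := maps_coord_inv gC hg.
    by subst; move/close_elt: hy.
  + move=> g gC hg; apply: he => //; apply: le_lt_trans re; apply: le_sep => //.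
      exact: ltW.
    (* A separating number [s > r] at [j] would put [j] into [A], where the coordinates are less
       than [r] apart. *)
    move=> s j s0 s1 jJ Kj hs; rewrite leNgt; apply/negP => rs.
    have jA : j ∈ A by apply/hA; split=> //; apply: K_le Kj => //; apply: ltW.
    have [W hW] : exists W, nbhs j W by apply: separation => //; definable.
    have WF : W ∈ F.
      by apply/hF; split; [apply/hPC => h /hW[]|exists j].
    have [_] := (nbhsP j W jJ hW g).1 (hg W WF); lra.
Qed.

End Cube.

(** * Iso-dense spaces *)

Section IsoDense.
Context (V : set_structure) (hV : ZF V) (R : real_data V)
  (hR : complete_ordered_field R).
Local Notation RR := (real hV hR).
Local Notation dist := (dist hV hR).
Implicit Types (r eps delta : RR) (f g h j x y z a b U : V).

Context (X d T : V) (hd : is_metric R X d) (hT : is_metric_topology R T X d).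
Context (D : V) (hD : forall x, x ∈ D <-> x ∈ X /\ isolated T x)
  (dense_D : dense X T D).
(** The common consequence of total boundedness and limit point compactness, and the only form in
    which they enter. *)
Context (iso_finite : forall eps B, 0 < eps ->
  (forall x, x ∈ B -> x ∈ X /\ iso_radius R d x (elt eps)) -> is_finite B).
Context (E : V) (hE : is_dyadic hV hR E) (w : V) (hw : is_omega w).

Let diso := definable_iso_radius R d.

Let DX x : x ∈ D -> x ∈ X.
Proof. by move=> /hD[]. Qed.

Let D_iso x : x ∈ D -> exists2 eps : RR, 0 < eps & iso_radius R d x (elt eps).
Proof. by move=> /hD[xX] /(isolated_iso_radius hV hR hd hT xX). Qed.

Let D_near x eps : x ∈ X -> 0 < eps -> exists j, j ∈ D /\ dist d x j < eps.
Proof.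
move=> xX eps0; have [b hb] := ball_exists hd eps xX.
have [||j [/hb[_ xj] jD]] := dense_D.2 b; last by exists j.
  exact: (ball_open hd hT xX hb).
by exists x; apply/hb; split=> //; rewrite (dist_eq0 hV hR hd xX xX).2.
Qed.

Lemma cuf_base_exists : exists B, is_base B T /\ is_cuf B.
Proof.
have [PX hPX] := powerset_exists hV X.
have [B hB] : exists B, forall b, b ∈ B <-> b ∈ PX /\
    exists x s, x ∈ D /\ s ∈ E /\ is_ball R b X d x s.
  by apply: separation => //; definable.
exists B; split; [split|].
- move=> b /hB[_ [x [s [/DX xX [/(dyadic_elt hE)[r ->] hb]]]]].
  exact: (ball_open hd hT xX (proj1 (is_ball_dist hd _ _ xX) hb)).
- move=> U x UT xU; have [sUX hU] := ((metric_topologyP hV hR hd T).1 hT U).1 UT.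
  have xX := sUX x xU; have [eps eps0 he] := hU x xU.
  (* A ball of radius [r < eps / 2] whose centre [j] is within [r] of [x] stays inside the ball of
     radius [eps] about [x]. *)
  have [|r [rE re]] := dyadic_small hE (r := eps / 2); first lra.
  have r0 := dyadic_gt0 hE rE.
  have [j [jD xj]] := D_near xX r0; have jX := DX jD.
  have [b hb] := ball_exists hd r jX; exists b; split; [|split].
  + apply/hB; split; first by apply/hPX => y /hb[].
    by exists j, (elt r); split=> //; split=> //; apply/is_ball_dist.
  + by apply/hb; split=> //; rewrite (dist_sym hV hR hd jX xX).
  + move=> y /hb[yX jy]; apply: he => //.
    by have := dist_triangle hV hR hd xX jX yX; lra.
(* The piece at [e] holds the balls whose centre has isolation radius [e] and whose radius is at
   least [e]: finitely many centres, and finitely many radii for each. *)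
apply: (is_cuf_dyadic hE hw (K := fun e b => exists x s, x ∈ D /\ s ∈ E /\
  le R e s /\ iso_radius R d x e /\ is_ball R b X d x s)); first by definable.
- move=> e C /[dup] eE /(dyadic_elt hE)[r Er] hC; subst.
  have r0 := dyadic_gt0 hE eE.
  have [De hDe] : exists De, forall x, x ∈ De <-> x ∈ D /\ iso_radius R d x (elt r).
    by apply: separation => //; definable.
  have [Ee hEe] : exists Ee, forall s, s ∈ Ee <-> s ∈ E /\ le R (elt r) s.
    by apply: separation => //; definable.
  apply: (finite_bigcup hV (F := fun x b => exists s, s ∈ Ee /\ is_ball R b X d x s)
    (A := De)).
  + by definable.
  + by apply: (iso_finite r0) => x /hDe[/DX].
  + move=> x C' /hDe[/DX xX _] hC'.
    apply: (finite_image hV (F := fun s b => is_ball R b X d x s) (A := Ee)).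
    * by definable.
    * apply: (dyadic_finite hE r0) => s /hEe[/[dup] sE /(dyadic_elt hE)[t ?]].
      by subst=> /le_elt; exists t.
    * by move=> s b b' _ _ _ h h'; apply: set_ext => // y; rewrite (h y) (h' y).
    * by move=> b /hC'[_].
  + move=> b /hC[_ [x [s [xD [sE [rs [hx hb]]]]]]].
    exists x; split; first exact/hDe.
    by exists s; split=> //; apply/hEe.
- move=> b /hB[_ [x [s [xD [/[dup] sE /(dyadic_elt hE)[t Et] hb]]]]]; subst.
  have [eps eps0 he] := D_iso xD.
  (* The index must lie below both the isolation radius of the centre and the radius of the ball. *)
  have [|r [rE re]] := dyadic_small hE (r := Num.min eps t).
    by rewrite lt_min eps0; apply: (dyadic_gt0 hE sE).
  move: re; rewrite lt_min => /andP[re rt].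
  exists (elt r); split=> //; exists x, (elt t); split=> //; split=> //.
  split; first by apply/le_elt; lra.
  split=> //; apply: (iso_radius_le hd (DX xD) _ he); exact: ltW.
Qed.

Lemma cube_embedding_exists : exists C TC e,
  is_tychonoff_cube R C TC /\ metrizable R C TC /\ is_embedding e X T C TC.
Proof.
have [J hJ] := setU_exists hV D E.
have [I hI] : exists I, is_unit_interval R I.
  by apply: separation => //; definable.
have [PI hPI] := powerset_exists hV I.
have [TI hTI] : exists TI, is_usual_topology R I TI.
  have [TI hTI] : exists TI, forall U, U ∈ TI <-> U ∈ PI /\ forall x, x ∈ U ->
      exists e, positive R e /\ forall y, y ∈ I -> close R x y e -> y ∈ U.
    by apply: separation => //; definable.
  by exists TI => U; rewrite hTI hPI.
have [C hC] := powers_exists hV J I.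
have [PC hPC] := powerset_exists hV C.
have [TC hTC] : exists TC, is_product_topology C J TI TC.
  have [TC hTC] : exists TC, forall U, U ∈ TC <-> U ∈ PC /\
      forall f, f ∈ U -> exists F, is_finite F /\
        (forall W, W ∈ F -> is_subbasic C J TI W /\ f ∈ W) /\
        (forall g, g ∈ C -> (forall W, W ∈ F -> g ∈ W) -> g ∈ U).
    by apply: separation => //; rewrite /is_subbasic; definable.
  by exists TC => U; rewrite hTC hPC.
(* [D] and [E] may overlap, as [D] is an arbitrary set. A common element has weight by either
   clause, and finiteness survives as that of a union of two finite sets. *)
pose K j a := (j ∈ D /\ iso_radius R d j a) \/ (j ∈ E /\ le R a j).
have dK : definable 2 (fun rho => K (rho 0%N) (rho 1%N)).
  by rewrite /K; definable.
have K_le j r eps : j ∈ J -> 0 < r -> r <= eps -> K j (elt eps) -> K j (elt r).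
  move=> _ _ re [[jD h]|[jE h]]; [left|right]; split=> //.
    exact: (iso_radius_le hd (DX jD) re h).
  by apply: (cof_le_trans hR) h; apply/le_elt.
have K_ex j : j ∈ J -> exists2 r : RR, 0 < r <= 1 & K j (elt r).
  move=> /hJ[jD|jE].
    have [eps eps0 he] := D_iso jD; exists (Num.min eps 1).
      by rewrite lt_min eps0 ltr01 ge_min lexx orbT.
    left; split=> //; apply: (iso_radius_le hd (DX jD) _ he).
    by rewrite ge_min lexx.
  have [r ?] := dyadic_elt hE jE; subst; exists r; first exact: (dyadic_itv hE jE).
  by right; split=> //; apply/le_elt.
have K_finite r B : 0 < r -> (forall j, j ∈ B -> j ∈ J /\ K j (elt r)) ->
    is_finite B.
  move=> r0 hB.
  have [B1 hB1] : exists B1, forall j, j ∈ B1 <-> j ∈ B /\ j ∈ D /\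
      iso_radius R d j (elt r).
    by apply: separation => //; definable.
  have [B2 hB2] : exists B2, forall j, j ∈ B2 <-> j ∈ B /\ j ∈ E /\ le R (elt r) j.
    by apply: separation => //; definable.
  apply: (@finite_setU _ hV B1 B2).
  - by apply: (iso_finite r0) => j /hB1[_ [/DX]].
  - apply: (dyadic_finite hE r0) => j /hB2[_ [/[dup] jE /(dyadic_elt hE)[s ?]]].
    by subst=> /le_elt; exists s.
  - move=> j; rewrite hB1 hB2; split=> [jB|[[]//|[]//]].
    by have [_ [h|h]] := hB j jB; [left|right].
have [rho [mrho trho lip coord_lt]] :=
  cube_metrizable hI hTI hC hTC dK K_le K_ex K_finite.
(* [G] defines the coordinates inside the model; [c] below computes the same values in the real
   field. *)
pose G x j b := (j ∈ D /\ exists a, maps2 d x j a /\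
    ((le R a (rone R) /\ b = a) \/ (~ le R a (rone R) /\ b = rone R))) \/
  (~ j ∈ D /\ b = rzero R).
have dG : definable 3 (fun rho => G (rho 0%N) (rho 1%N) (rho 2%N)).
  by rewrite /G; definable.
pose c x j : RR := if pselect (j ∈ D) then Num.min (dist d x j) 1 else 0.
have GP x j b : x ∈ X -> G x j b <-> b = elt (c x j).
  move=> xX; rewrite /G /c -(elt0 hV hR) -(elt1 hV hR).
  case: pselect => jD /=; last by split=> [[[]|[]]//|->]; right.
  have m : maps2 d x j (elt (dist d x j)) := maps2_dist hV hR hd xX (DX jD).
  split=> [[[_ [a [/(maps2_dist_inv hV hR hd)[_ _ ->]]]]|[]//]|->].
    by case=> [[/le_elt h ->]|[/le_elt/negP h ->]]; congr elt;
      [rewrite min_l|rewrite min_r // ltW // ltNge].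
  left; split=> //; exists (elt (dist d x j)); split=> //.
  have [h|h] := leP (dist d x j) 1; [left|right]; split=> //; first exact/le_elt.
  by move=> /le_elt; rewrite leNgt h.
have c_itv x j : x ∈ X -> j ∈ J -> 0 <= c x j <= 1.
  move=> xX _; rewrite /c; case: pselect => [jD|jND] /=; last by rewrite lexx ler01.
  by rewrite le_min ge_min lexx orbT ler01 (dist_ge0 hV hR hd xX (DX jD)).
have [f [ff hf]] : exists f, is_fun f X C /\ forall x, x ∈ X ->
    forall j, j ∈ J -> exists b, maps (app f x) j b /\ G x j b.
  apply: (fun_exists hV (F := fun x g =>
    forall j, j ∈ J -> exists b, maps g j b /\ G x j b)); first by definable.
    move=> x xX; have [g [gf hg]] : exists g, is_fun g J I /\
        forall j, j ∈ J -> G x j (app g j).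
      apply: (fun_exists hV (F := G x)).
      - by definable.
      - move=> j jJ; exists (elt (c x j)); split; last exact/GP.
        apply/hI; split; first exact: elt_in.
        rewrite -(elt0 hV hR) -(elt1 hV hR) !le_elt.
        by have /andP[] := c_itv x j xX jJ.
      - by move=> j b b' _ _ _ /(GP _ _ _ xX)-> /(GP _ _ _ xX)->.
    exists g; split=> [|j jJ]; first exact/hC.
    by exists (app g j); split; [exact: maps_app gf jJ|exact: hg].
  move=> x g g' xX /hC gf /hC g'f h h'; apply: (fun_ext hV gf g'f) => j jJ.
  have [b [hb /(GP _ _ _ xX) ?]] := h j jJ.
  have [b' [hb' /(GP _ _ _ xX) ?]] := h' j jJ.
  by subst; rewrite (maps_eq gf hb) (maps_eq g'f hb').
have coordE x j : x ∈ X -> j ∈ J -> proj hV hR (app f x) j = c x j.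
  move=> xX jJ; have fxC := app_in ff xX.
  have [b [hb /(GP _ _ _ xX) ?]] := hf x xX j jJ; subst.
  by have [_ /elt_inj] := maps_coord_inv hV hR hI hC fxC hb.
exists C, TC, f; split; [|split].
- exists J, I, TI; split=> //.
  by apply: (dyadic_infinite hE) => j jE; apply/hJ; right.
- by exists rho.
apply: (metric_embedding hd hT mrho trho ff).
(* Each coordinate is 1-Lipschitz in [x]. Halving [eps] turns the weak bound from [lip] into a
   strict one. *)
- move=> x eps xX eps0; exists (eps / 2) => [|y yX xy]; first lra.
  apply: (@le_lt_trans _ _ (eps / 2)); last lra.
  apply: lip; [exact: app_in ff xX|exact: app_in ff yX|lra|].
  move=> j jJ; rewrite !coordE // /c; case: pselect => [jD|jND] /=; last first.
    by rewrite subrr normr0; lra.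
  have jX := DX jD.
  have h1 := dist_triangle hV hR hd xX yX jX.
  have h2 := dist_triangle hV hR hd yX xX jX.
  have h3 := dist_sym hV hR hd xX yX.
  by rewrite ler_norml; case: (leP (dist d x j) 1) => h4;
    case: (leP (dist d y j) 1) => h5; apply/andP; split; lra.
(* Take [j] in [D] within [eta] of [x]. If coordinate [j] changes by less than [eta], then that of
   [y] is below [2 eta <= 1 / 2], so it is not truncated. Hence [x] and [y] are less than
   [3 eta < eps] apart. *)
- move=> x eps xX eps0; pose eta := Num.min (eps / 4) (1 / 4).
  have eta0 : 0 < eta by rewrite lt_min; apply/andP; split; lra.
  have [ee e1] : eta <= eps / 4 /\ eta <= 1 / 4.
    by rewrite /eta !ge_min !lexx orbT.
  have [j [jD xj]] := D_near xX eta0; have jX := DX jD.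
  have jJ : j ∈ J by apply/hJ; left.
  have [r /andP[r0 r1] Kj] := K_ex j jJ.
  have m0 : 0 < Num.min r eta by rewrite lt_min r0.
  have m1 : Num.min r eta <= 1 by rewrite ge_min r1.
  have Km : K j (elt (Num.min r eta)) by apply: K_le Kj => //; rewrite ge_min lexx.
  exists (Num.min r eta) => // y yX hy.
  have := coord_lt _ _ _ _ (app_in ff xX) (app_in ff yX) jJ m0 m1 Km hy.
  rewrite !coordE // /c; case: pselect => // jD' /=.
  rewrite lt_min => /andP[_]; rewrite ltr_norml => /andP[h1 h2].
  have h3 := dist_triangle hV hR hd xX jX yX.
  have h4 := dist_sym hV hR hd yX jX.
  by move: h1 h2; case: (leP (dist d x j) 1) => h5;
    case: (leP (dist d y j) 1) => h6 h1 h2; lra.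
Qed.

End IsoDense.

(** * Reduction of both hypotheses to the finiteness of the sets of points with a given isolation
    radius *)

Theorem theorem3p7 (V : set_structure) (hV : ZF V)
    (R : real_data V) (hR : complete_ordered_field R)
    (X d T : V) (hd : is_metric R X d) (hT : is_metric_topology R T X d)
    (hiso : iso_dense X T)
    (hX : totally_bounded R X d \/ limit_point_compact X T) :
  (exists B : V, is_base B T /\ is_cuf B) /\
  (exists C TC e : V,
     is_tychonoff_cube R C TC /\ metrizable R C TC /\
     is_embedding e X T C TC).
Proof.
have [D [hD dense_D]] := hiso.
have [E hE] := dyadic_exists hV hR; have [w hw] := omega_exists hV.
have iso_finite (eps : real hV hR) B : 0 < eps ->
    (forall x, x ∈ B -> x ∈ X /\ iso_radius R d x (elt eps)) -> is_finite B.
  move=> eps0 hB; case: hX => [tb|lpc].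
    exact: (totally_bounded_iso_finite hd tb eps0 hB).
  exact: (limit_point_compact_iso_finite hd hT lpc eps0 hB).
split; first exact: (cuf_base_exists hd hT hD dense_D iso_finite hE hw).
exact: (cube_embedding_exists hd hT hD dense_D iso_finite hE).
Qed.
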